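(* Let $\epsilon \in (0, 1/2)$ be an absolute constant. There is a CRCW PRAM algorithm that, given a \textsc{SetCover} instance in which each element appears in at most $f$ sets, computes a set cover whose size is, in expectation, at most $(1+\epsilon)f$ times the minimum set cover size. The algorithm deterministically runs in $O(n + m)$ work and $O(\log n)$ depth.
   Context: A \textsc{SetCover} instance consists of a family of sets $S$ and a collection of elements $T$, represented as a bipartite graph with an edge between set $s$ and element $t$ iff $t\in s$; a set cover is a subfamily of $S$ whose union contains all of $T$. $n=|S|+|T|$ and $m$ is the total size of all sets. In the concurrent-read concurrent-write parallel random access machine (CRCW PRAM), the work of an algorithm is its total number of operations and its depth is the number of parallel time steps. *)

(* Defs.v *)
From HB Require Import structures.
From mathcomp Require Import all_boot all_order all_algebra.

Set Implicit Arguments.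
Unset Strict Implicit.
Unset Printing Implicit Defensive.

Import GRing.Theory.

(** * Set cover *)

(* An instance is a bipartite graph [E] between the sets ['I_nS] and the
   elements ['I_nT]; [(s, t) \in E] means that element t belongs to set s. *)
Section SetCover.
Variables nS nT : nat.
Implicit Types (E : {set 'I_nS * 'I_nT}) (A : {set 'I_nS}).

Definition is_cover E A : bool :=
  [forall t : 'I_nT, exists s : 'I_nS, (s \in A) && ((s, t) \in E)].

Definition sets_containing E (t : 'I_nT) : {set 'I_nS} :=
  [set s | (s, t) \in E].

(* Meaningful only when the whole family is a cover, [is_cover E setT]. *)
Definition min_cover_size E : nat :=
  #|[arg min_(A < [set: 'I_nS] | is_cover E A) #|A| ]|.

End SetCover.

(** * A randomized CRCW PRAM on w-bit words, in work-depth form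

   A program is one fixed finite text, independent of the input, built from
   synchronous parallel instructions [Pardo k g a v]:

     for 0 <= i < k pardo  if g(i) <> 0 then memory[a(i)] := v(i)

   with [k] computed at run time.  All [k] processors evaluate the constant-size
   expressions [g], [a], [v] on the shared memory as it was before the
   instruction, and then write simultaneously.  Concurrent reads and writes are
   allowed; conflicting writes follow the ARBITRARY rule: exactly one of the
   competing processors succeeds, and an adversary chooses which. *)

Inductive binop := OAdd | OSub | OMul | ODiv | OMod | OEqb | OLtb.

Inductive expr :=
| Cst of nat
| Pid                        (* index of the evaluating processor *)
| Rnd                        (* fresh random word, per processor and instruction *)
| Read of expr               (* shared-memory access *)
| Bin of binop & expr & expr
| Ite of expr & expr & expr.

Inductive cmd :=
| Pardo (k g a v : expr)
| Seq of cmd & cmd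
| If of expr & cmd & cmd
| While of expr & cmd.

(* Number of unit operations: one per node.  Both branches of [Ite] are charged,
   so this bounds the operations actually performed from above. *)
Fixpoint cost (e : expr) : nat :=
  match e with
  | Cst _ | Pid | Rnd => 1
  | Read e1 => (cost e1).+1
  | Bin _ e1 e2 => (cost e1 + cost e2).+1
  | Ite e1 e2 e3 => (cost e1 + cost e2 + cost e3).+1
  end.

(* Subtraction is truncated at 0; as in ssrnat, x %/ 0 = 0 and x %% 0 = x. *)
Definition binop_sem (o : binop) (x y : nat) : nat :=
  match o with
  | OAdd => x + y
  | OSub => x - y
  | OMul => x * y
  | ODiv => x %/ y
  | OMod => x %% y
  | OEqb => x == y
  | OLtb => x < y
  end.

(* Value for processor [i] holding the random word [r].  Every intermediate
   value, hence every address and every value written, is reduced to a w-bit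
   word. *)
Fixpoint eval (w : nat) (m : nat -> nat) (i r : nat) (e : expr) : nat :=
  match e with
  | Cst c => c
  | Pid => i
  | Rnd => r
  | Read e1 => m (eval w m i r e1)
  | Bin o e1 e2 => binop_sem o (eval w m i r e1) (eval w m i r e2)
  | Ite e1 e2 e3 =>
      if eval w m i r e1 != 0 then eval w m i r e2 else eval w m i r e3
  end %% 2 ^ w.

Record state := State {
  memory : nat -> nat;
  depth : nat;               (* parallel time steps so far *)
  work : nat                 (* operations so far *)
}.

(* The random words available during the first D time steps to the first K
   processors.  A run of depth at most D and work at most K never consults
   [draw] outside this table: each random word is read at a time before the end
   of the run, by a processor whose index is less than the work of the run. *)
Definition tape (w D K : nat) := {ffun 'I_D * 'I_K -> 'I_(2 ^ w)}.

Definition draw w D K (om : tape w D K) (t i : nat) : nat :=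
  match insub t, insub i with
  | Some t', Some i' => om (t', i')
  | _, _ => 0
  end.

Section Semantics.
Variables (w D K : nat) (om : tape w D K).

(* Write-conflict resolution: among the competing processors, listed in
   increasing order, the one at position [rho t a] (modulo their number) wins
   the write to address [a] of the instruction whose body starts at time [t]. *)
Variable rho : nat -> nat -> nat.

(* Expressions outside the body of a [Pardo] are evaluated by processor 0. *)
Definition eval0 (s : state) (e : expr) : nat :=
  eval w (memory s) 0 (draw om (depth s) 0) e.

Definition charge (s : state) (d x : nat) : state :=
  State (memory s) (depth s + d) (work s + x).

Definition writers (s : state) (k : nat) (g a : expr) (x : nat) : seq nat :=
  [seq i <- iota 0 k |
    (eval w (memory s) i (draw om (depth s) i) g != 0) &&
    (eval w (memory s) i (draw om (depth s) i) a == x)].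

Definition par_write (s : state) (k : nat) (g a v : expr) (x : nat) : nat :=
  let ws := writers s k g a x in
  if ws is [::] then memory s x else
  let i := nth 0 ws (rho (depth s) x %% size ws) in
  eval w (memory s) i (draw om (depth s) i) v.

Definition pardo (s : state) (k : nat) (g a v : expr) : state :=
  let c := (cost g + cost a + cost v).+1 in
  State (par_write s k g a v) (depth s + c) (work s + k * c).

(* [exec p s s']: program [p] started in [s] halts in [s']. *)
Inductive exec : cmd -> state -> state -> Prop :=
| exec_pardo k g a v s :
    exec (Pardo k g a v) s
      (pardo (charge s (cost k) (cost k)) (eval0 s k) g a v)
| exec_seq p q s s1 s2 :
    exec p s s1 -> exec q s1 s2 -> exec (Seq p q) s s2
| exec_if_true e p q s s' :
    eval0 s e != 0 -> exec p (charge s (cost e) (cost e)) s' ->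
    exec (If e p q) s s'
| exec_if_false e p q s s' :
    eval0 s e = 0 -> exec q (charge s (cost e) (cost e)) s' ->
    exec (If e p q) s s'
| exec_while_true e p s s1 s2 :
    eval0 s e != 0 -> exec p (charge s (cost e) (cost e)) s1 ->
    exec (While e p) s1 s2 -> exec (While e p) s s2
| exec_while_false e p s :
    eval0 s e = 0 -> exec (While e p) s (charge s (cost e) (cost e)).

Lemma exec_det p s s1 s2 : exec p s s1 -> exec p s s2 -> s1 = s2.
Proof.
move=> H; elim: H s2 => {p s s1}.
- by move=> k g a v s s2 H; inversion H.
- move=> p q s s1 s2 _ IH1 _ IH2 s3 H; inversion_clear H as [|? ? ? s4 ? H1 H2| | | |].
  by apply: IH2; rewrite (IH1 _ H1).
- move=> e p q s s' He _ IH s2 H; inversion_clear H as [| |? ? ? ? ? _ H2|? ? ? ? ? H1 _| |].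
    exact: IH.
  by rewrite H1 in He.
- move=> e p q s s' He _ IH s2 H; inversion_clear H as [| |? ? ? ? ? H1 _|? ? ? ? ? _ H2| |].
    by rewrite He in H1.
  exact: IH.
- move=> e p s s1 s2 He _ IH1 _ IH2 s3 H.
  inversion_clear H as [| | | |? ? ? s4 ? _ H1 H2|? ? ? H1].
    by apply: IH2; rewrite (IH1 _ H1).
  by rewrite H1 in He.
- move=> e p s He s2 H; inversion_clear H as [| | | |? ? ? s4 ? H1 _ _|? ? ? _] => //.
  by rewrite He in H1.
Qed.

End Semantics.

(** * Input and output conventions *)

(* Memory holds |S|, |T|, m at addresses 0, 1, 2, followed by the m edges as
   pairs of words, in the order of the list [es]; it is 0 elsewhere. *)
Definition input_words nS nT (es : seq ('I_nS * 'I_nT)) : seq nat :=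
  [:: nS; nT; size es] ++ flatten [seq [:: val e.1; val e.2] | e <- es].

Definition init_state nS nT (es : seq ('I_nS * 'I_nT)) : state :=
  State (nth 0 (input_words es)) 0 0.

(* Membership flags of the output family, stored right after the input. *)
Definition output nS nT (es : seq ('I_nS * 'I_nT)) (s : state) : {set 'I_nS} :=
  [set x : 'I_nS | memory s (3 + 2 * size es + x) != 0].

Local Open Scope ring_scope.

(* Over independent uniform random words. *)
Definition expectation (R : fieldType) w D K (X : tape w D K -> R) : R :=
  (\sum_(om : tape w D K) X om) / #|{: tape w D K}|%:R.

(* Main.v *)
(* Every element t draws a random time x_t below N = q^2 (|S|+|T|+1).  Times are
   cut into L = O(log n) consecutive buckets whose widths q, q + q/q, ... grow by a
   factor at most 1+1/q.  Round j samples the elements of bucket j not yet covered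
   and chooses all sets containing them.  A set s meets the sample in one round
   only, since it is then covered entirely.  While s is not hit, its k uncovered
   elements have independent times in the buckets >= j; if a fraction p_j of these
   times lies in bucket j, then A + k p_j bounds the expected number of sampled
   elements of s from round j on: by Bernoulli's inequality this potential does not
   increase in expectation as soon as every bucket is at most A times larger than
   the previous one.  Hence E|sample /\ s| <= A + |T| p_0 <= 1 + 5/q.  Summing over
   the sets of an optimal cover bounds the sample, and every sampled element costs
   at most f sets.

   Linear work requires that round j visit only the edges whose element is in
   bucket j, so the edges are first counting-sorted by bucket.  They are split into
   G = m/L + 1 residue classes mod G, each treated sequentially in L steps; the L G
   counters, one per bucket and class, are summed sequentially within G blocks of
   L counters, and the block totals by doubling windows, with work
   G log G = O(m + L).  All concurrent writes of the program agree, so the adversary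
   resolving them has no influence. *)
Require Import Defs.
From mathcomp Require Import all_boot all_order all_algebra.
From mathcomp Require Import reals zify ring lra.
Set Implicit Arguments.
Unset Strict Implicit.
Unset Printing Implicit Defensive.
Import Order.TTheory GRing.Theory Num.Theory.

(** * Expected number of hits in the first round that hits *)

Section FirstHit.
Local Open Scope ring_scope.
Variables (R : realFieldType) (I W : finType) (beta : W -> nat).
Variables (V : nat -> {ffun I -> W} -> {set I}) (A : R).
Implicit Types (y : {ffun I -> W}) (h : {ffun I -> option W}).

Let bucket j : R := #|[set w | beta w == j]|%:R.
Let tail j : R := #|[set w | (j <= beta w)%N]|%:R.

Hypothesis A_ge0 : 0 <= A.
Hypothesis bucket_growth : forall j, bucket j.+1 <= A * bucket j.
(* V j y is a random subset of the coordinates, determined by the coordinates of y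
   in the buckets before j, and emptied by the first round that hits it. *)
Hypothesis V_adapted : forall j y y',
  (forall i, (beta (y i) < j)%N || (beta (y' i) < j)%N -> y i = y' i) -> V j y = V j y'.
Hypothesis V_late : forall j y i, i \in V j y -> (j <= beta (y i))%N.
Hypothesis V_decr : forall j y, V j.+1 y \subset V j y.
Hypothesis V_hit : forall j y i, i \in V j y -> beta (y i) = j -> V j.+1 y = set0.

Definition hits j y : R := #|[set i in V j y | beta (y i) == j]|%:R.
(** The second term is the conditional expectation of the hits of round [j], and [A] is reserved for
    all later rounds. Once [V] is empty no hit can follow. *)
Definition potential j y : R :=
  if V j y == set0 then 0 else A + #|V j y|%:R * (bucket j / tail j).

(** An atom of the information revealed before round [j]: [None] keeps only the fact that the
    coordinate lies in no earlier bucket. *)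
Let history j y : {ffun I -> option W} :=
  [ffun i => if (beta (y i) < j)%N then Some (y i) else None].

Lemma tail_split j : tail j = bucket j + tail j.+1.
Proof.
rewrite /tail /bucket -natrD; congr _%:R.
rewrite -(cardsID [set w | beta w == j]); congr (_ + _)%N; apply: eq_card => w; rewrite !inE.
  by case: eqP => [->|]; rewrite ?leqnn ?andbF.
by rewrite [RHS]ltn_neqAle eq_sym andbC.
Qed.

(** A conditional expectation without its normalisation: on an atom the coordinates are independent,
    and those recorded as [None] are uniform on the words of the buckets from [j] on. *)
Lemma sum_history j h (S : {set I}) (g : W -> R) :
  (forall i, i \in S -> h i = None) -> 0 < tail j ->
  \sum_(y | history j y == h) \prod_(i in S) g (y i) =
  (\sum_(y | history j y == h) 1) *
    ((\sum_(w | (j <= beta w)%N) g w) / tail j) ^+ #|S|.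
Proof.
move=> hS tail_gt0.
(* The atom is a product of the sets [Q i], so sums of products over it factor. *)
pose Q i := [pred w | (if (beta w < j)%N then Some w else None) == h i].
have fam : forall y, (history j y == h) = (y \in family Q).
  move=> y; apply/eqP/familyP => [hE i|yQ]; first by rewrite inE /= -hE ffunE eqxx.
  by apply/ffunP => i; have := yQ i; rewrite inE ffunE => /eqP.
have E (F : I -> W -> R) : \sum_(y | history j y == h) \prod_i F i (y i) =
    \prod_i \sum_(w | Q i w) F i w.
  by rewrite bigA_distr_big_dep; apply: eq_bigl => y; rewrite fam.
have E1 : \sum_(y | history j y == h) 1 = \prod_i \sum_(w | Q i w) (1 : R).
  by rewrite -(E (fun _ _ => 1)); apply: eq_bigr => y _; rewrite big1.
have E2 : \sum_(y | history j y == h) \prod_(i in S) g (y i) =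
    \prod_i \sum_(w | Q i w) (if i \in S then g w else 1).
  by rewrite -(E (fun i w => if i \in S then g w else 1)); apply: eq_bigr => y _; rewrite big_mkcond.
have QS i : i \in S -> forall w, Q i w = (j <= beta w)%N.
  by move=> iS w; rewrite /= (hS i iS) ltnNge; case: leq.
rewrite E1 E2 (bigID (mem S)) /= [in RHS](bigID (mem S)) /= -mulrA [_ * (_ ^+ _)]mulrC mulrA.
congr (_ * _); last by apply: eq_bigr => i /negbTE iS; apply: eq_bigr => w _; rewrite iS.
rewrite -[_ ^+ #|S|]prodr_const -big_split /=; apply: eq_bigr => i iS.
rewrite (eq_bigl _ _ (QS i iS)) [X in _ = X * _](eq_bigl _ _ (QS i iS)).
have -> : \sum_(w | (j <= beta w)%N) (1 : R) = tail j.
  by rewrite sumr_const /tail; congr _%:R; apply: eq_card => w; rewrite !inE.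
rewrite mulrC divfK ?gt_eqF //; apply: eq_bigr => w _; by rewrite iS.
Qed.

Lemma bernoulli (x : R) k : 0 <= x -> 1 + k%:R * x <= (1 + x) ^+ k.
Proof.
move=> x0; elim: k => [|k IH]; first by rewrite mul0r addr0 expr0.
rewrite exprS; apply: le_trans (_ : (1 + x) * (1 + k%:R * x) <= _); last first.
  by rewrite ler_wpM2l // addr_ge0.
have : 0 <= k%:R * (x * x) by rewrite mulr_ge0 // mulr_ge0.
rewrite -natr1; nra.
Qed.

(** The power is the probability that [k] coordinates all miss bucket [j]. By Bernoulli its inverse
    is at least [1 + k * bucket j / tail j.+1], and [A] times this dominates the other factor
    because [bucket j.+1 <= A * bucket j]. *)
Lemma potential_step_ineq j k : (0 < k)%N -> 0 < tail j ->
  (tail j.+1 / tail j) ^+ k * (A + k%:R * (bucket j.+1 / tail j.+1)) <= A.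
Proof.
move=> k0 t0; have b0 i : 0 <= bucket i by rewrite ler0n.
have := ler0n R #|[set w | (j.+1 <= beta w)%N]|; rewrite le_eqVlt => /orP[/eqP E|t1].
  by rewrite -/(tail j.+1) in E; rewrite -E mul0r expr0n gtn_eqF // mul0r.
rewrite -/(tail j.+1) in t1.
have /(bernoulli k) := divr_ge0 (b0 j) (ltW t1).
have -> : 1 + bucket j / tail j.+1 = (tail j.+1 / tail j)^-1.
  by rewrite invf_div [tail j]tail_split mulrDl divff ?gt_eqF // addrC.
move=> H; have p0 : 0 < (tail j.+1 / tail j) ^+ k by rewrite exprn_gt0 // divr_gt0.
rewrite mulrC -ler_pdivlMr // -exprVn; apply: le_trans (ler_wpM2l A_ge0 H).
rewrite mulrDr mulr1 lerD2l [leRHS]mulrCA ler_wpM2l // [leRHS]mulrA ler_wpM2r // invr_ge0; exact: ltW.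
Qed.

(** Checked on each atom of [history j]: the hits use up exactly the second term of the potential,
    so the next potential must be at most [A] on average. *)
Lemma potential_step j : \sum_y (hits j y + potential j.+1 y) <= \sum_y potential j y.
Proof.
rewrite (partition_big (history j) xpredT) //= [leRHS](partition_big (history j) xpredT) //=.
apply: ler_sum => h _.
case: (pickP (fun y => history j y == h)) => [y0 /eqP h0|no]; last by rewrite !big_pred0.
have VE y : history j y == h -> V j y = V j y0.
  rewrite -h0 => /eqP /ffunP H; apply: V_adapted => i; have := H i; rewrite !ffunE.
  by case: ltnP => _; case: ltnP => _ // [].
case: (boolP (V j y0 == set0)) => [/eqP V0|Vn0].
  rewrite [leLHS]big1 ?sumr_ge0 // => y yh.
    by rewrite /potential VE // V0 eqxx.
  have V1 : V j.+1 y = set0 by apply/eqP; rewrite -subset0 -V0 -(VE y yh) V_decr.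
  rewrite /potential /hits VE // V1 V0 eqxx addr0.
  by rewrite (_ : [set i in _ | _] = set0) ?cards0 //; apply/setP => i; rewrite !inE.
have [i0 i0V] := set0Pn _ Vn0.
have tail_gt0 : 0 < tail j.
  by rewrite ltr0n card_gt0; apply/set0Pn; exists (y0 i0); rewrite inE; apply: V_late.
have hV i : i \in V j y0 -> h i = None.
  by move=> /V_late le; rewrite -h0 ffunE ltnNge le.
set k := #|V j y0|; have k0 : (0 < k)%N by rewrite card_gt0.
set N : R := \sum_(y | history j y == h) 1.
have N0 : 0 <= N by rewrite sumr_ge0.
have RHS_E : \sum_(y | history j y == h) potential j y =
    N * (A + k%:R * (bucket j / tail j)).
  by rewrite big_distrl /=; apply: eq_bigr => y yh; rewrite /potential VE // (negbTE Vn0) mul1r.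
rewrite RHS_E big_split /=.
have hits_E : \sum_(y | history j y == h) hits j y = N * (k%:R * (bucket j / tail j)).
  pose g w : R := (beta w == j)%:R.
  rewrite (eq_bigr (fun y => \sum_(i in V j y0) \prod_(i' in [set i]) g (y i'))); last first.
    move=> y yh; rewrite /hits VE // (eq_bigr (fun i => (beta (y i) == j)%:R)); last first.
      by move=> i _; rewrite big_set1.
    rewrite -natr_sum; congr _%:R; rewrite -sum1_card big_mkcond [RHS]big_mkcond /=.
    by apply: eq_bigr => i _; rewrite !inE; case: (i \in _) => //=; case: eqP.
  rewrite exchange_big /= (eq_bigr (fun=> N * (bucket j / tail j))); last first.
    move=> i iV; rewrite (@sum_history j) //; last by move=> i'; rewrite inE => /eqP ->; apply: hV.
    rewrite cards1 expr1; congr (_ * (_ / _)).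
    rewrite /g -natr_sum /bucket; congr _%:R; rewrite -sum1_card big_mkcond [RHS]big_mkcond /=.
    by apply: eq_bigr => w _; rewrite !inE; case: eqP => [->|]; rewrite ?leqnn ?if_same.
  by rewrite sumr_const -/k -[LHS]mulr_natl mulrCA.
rewrite hits_E addrC mulrDr lerD2r.
(* The product of [g] over [V j y0] indicates that round [j] misses; after a hit [V j.+1] is empty
   and the next potential vanishes. *)
pose g w : R := (beta w != j)%:R.
apply: le_trans (_ : \sum_(y | history j y == h)
   (\prod_(i in V j y0) g (y i)) * (A + k%:R * (bucket j.+1 / tail j.+1)) <= _).
  apply: ler_sum => y yh.
  have c0 : 0 <= A + k%:R * (bucket j.+1 / tail j.+1).
    by rewrite addr_ge0 // mulr_ge0 // divr_ge0 // ler0n.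
  have prod0 : 0 <= \prod_(i in V j y0) g (y i) by apply: prodr_ge0 => i _; rewrite ler0n.
  rewrite /potential; case: ifP => [_|/negbT V1n0]; first by rewrite mulr_ge0.
  rewrite big1 ?mul1r; last first.
    move=> i iV; rewrite /g; case: eqP => //= bi; move: V1n0.
    by rewrite (V_hit (i := i)) ?eqxx // VE.
  rewrite lerD2l ler_wpM2r // ?divr_ge0 ?ler0n // ler_nat.
  by rewrite /k -(VE y yh) subset_leq_card.
rewrite -mulr_suml (@sum_history j) // -/N -/k.
have -> : \sum_(w | (j <= beta w)%N) g w = tail j.+1.
  rewrite /g -natr_sum /tail; congr _%:R; rewrite -sum1_card big_mkcond [RHS]big_mkcond /=.
  by apply: eq_bigr => w _; rewrite !inE ltn_neqAle eq_sym; case: leq; case: eqP.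
by rewrite -mulrA ler_wpM2l // potential_step_ineq.
Qed.

Lemma sum_hits L :
  \sum_y \sum_(j < L) hits j y <= \sum_y potential 0 y.
Proof.
have pot0 j y : 0 <= potential j y.
  by rewrite /potential; case: ifP => // _; rewrite addr_ge0 // mulr_ge0 // divr_ge0 // ler0n.
(* Keeping the leftover potential lets the induction on [L] telescope. *)
suff: \sum_y (\sum_(j < L) hits j y + potential L y) <= \sum_y potential 0 y.
  by apply: le_trans; apply: ler_sum => y _; rewrite lerDl.
elim: L => [|L IH]; first by apply: ler_sum => y _; rewrite big_ord0 add0r.
apply: le_trans IH; under eq_bigr do rewrite big_ord_recr -addrA /=.
by rewrite !big_split /= lerD2l -big_split; apply: potential_step.
Qed.

End FirstHit.

(** * The rounds of the algorithm *)

Section Rounds.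
Local Open Scope ring_scope.
Variables (nS nT : nat) (E : {set 'I_nS * 'I_nT}).
Implicit Types (b : 'I_nT -> nat) (C : {set 'I_nS}).

Definition covered C (t : 'I_nT) : bool := [exists s in C, (s, t) \in E].

Fixpoint chosen b j : {set 'I_nS} :=
  if j is j'.+1 then
    chosen b j' :|:
    \bigcup_(t | (b t == j') && ~~ covered (chosen b j') t) sets_containing E t
  else set0.

Definition sampled b j : {set 'I_nT} :=
  [set t | (b t == j) && ~~ covered (chosen b j) t].

Lemma chosenS b j :
  chosen b j.+1 = chosen b j :|: \bigcup_(t in sampled b j) sets_containing E t.
Proof. by congr (_ :|: _); apply: eq_bigl => t; rewrite inE. Qed.

Lemma covered_sub C C' t : C \subset C' -> covered C t -> covered C' t.
Proof.
by move=> /subsetP CC' /exists_inP[s sC st]; apply/exists_inP; exists s => //; apply: CC'.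
Qed.

Lemma chosen_sub b i j : (i <= j)%N -> chosen b i \subset chosen b j.
Proof.
move=> /subnKC <-; elim: (j - i)%N => [|k IH]; first by rewrite addn0.
by rewrite addnS; apply: subset_trans IH _; apply: subsetUl.
Qed.

Lemma sampled_chosen b j s t : t \in sampled b j -> (s, t) \in E -> s \in chosen b j.+1.
Proof.
move=> tj st; rewrite chosenS inE; apply/orP; right.
by apply/bigcupP; exists t => //; rewrite inE.
Qed.

(** Round [i] only asks which elements carry label [i], so labels from [j] on are never consulted in
    the first [j] rounds. *)
Lemma chosen_adapted b b' j :
  (forall t, (b t < j)%N || (b' t < j)%N -> b t = b' t) -> chosen b j = chosen b' j.
Proof.
elim: j => [|j IH] bb' //=.
rewrite -IH => [|t tj]; last by apply: bb'; case/orP: tj => H; rewrite (ltn_trans H) ?orbT.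
congr (_ :|: _); apply: eq_bigl => t; case: eqP => [E1|N1].
  by rewrite -bb' ?E1 ?ltnSn // eqxx.
by case: eqP => // E2; case: N1; rewrite bb' ?E2 // ltnSn orbT.
Qed.

Lemma chosen_is_cover b L :
  is_cover E [set: 'I_nS] -> (forall t, (b t < L)%N) -> is_cover E (chosen b L).
Proof.
move=> /forallP cov bL; apply/forallP => t; rewrite -/(covered (chosen b L) t).
apply: covered_sub (chosen_sub b (bL t)) _.
case: (boolP (covered (chosen b (b t)) t)) => [|nc].
  by apply: covered_sub; apply: chosen_sub.
have /existsP[s /andP[_ st]] := cov t.
by apply/exists_inP; exists s => //; apply: sampled_chosen st; rewrite inE eqxx.
Qed.

Lemma card_chosen b f L : (forall t, (#|sets_containing E t| <= f)%N) ->
  (#|chosen b L| <= f * \sum_(j < L) #|sampled b j|)%N.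
Proof.
move=> hf; elim: L => [|L IH]; first by rewrite big_ord0 cards0.
rewrite chosenS big_ord_recr mulnDr; apply: leq_trans (leq_card_setU _ _) _.
apply: leq_add => //; rewrite -[#|sampled b L|]sum1_card big_distrr /=.
elim/big_rec2: _ => [|t k B _ leBk]; first by rewrite cards0.
by apply: leq_trans (leq_card_setU _ _) _; rewrite muln1 leq_add.
Qed.

Lemma card_sampled b C j : is_cover E C ->
  (#|sampled b j| <= \sum_(s in C) #|[set t in sampled b j | (s, t) \in E]|)%N.
Proof.
move=> /forallP cov; rewrite -sum1_card.
apply: leq_trans (_ : \sum_(t in sampled b j) \sum_(s in C) ((s, t) \in E) <= _)%N.
  apply: leq_sum => t _; have /existsP[s /andP[sC st]] := cov t.
  by rewrite (bigD1 s) //= st leq_addr.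
rewrite exchange_big; apply: leq_sum => s _; rewrite -sum1_card big_mkcond [leqRHS]big_mkcond /=.
by apply: leq_sum => t _; rewrite !inE; case: (_ && ~~ _); case: (_ \in _).
Qed.

(** * Expected number of chosen sets *)

Section Expectation.
Variables (R : realFieldType) (I W : finType) (beta : W -> nat).
Variables (pos : 'I_nT -> I) (A kappa : R).
Hypothesis pos_inj : injective pos.
Hypothesis A_ge0 : 0 <= A.

Let bucket j : R := #|[set w | beta w == j]|%:R.
Let label (y : {ffun I -> W}) t : nat := beta (y (pos t)).

Hypothesis bucket_growth : forall j, bucket j.+1 <= A * bucket j.
Hypothesis kappa_ge : A + nT%:R * (bucket 0 / #|W|%:R) <= kappa.

(** An instance of [sum_hits] for the uncovered elements of [s]: the first one sampled brings [s]
    into the family, which covers them all. *)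
Lemma sum_sampled_in_set (s : 'I_nS) L :
  \sum_y \sum_(j < L) #|[set t in sampled (label y) j | (s, t) \in E]|%:R
  <= kappa * #|{: {ffun I -> W}}|%:R.
Proof.
pose U j y := [set t | [&& (s, t) \in E, (j <= label y t)%N & ~~ covered (chosen (label y) j) t]].
pose V j y := pos @: U j y.
have chosen_hit j y t : t \in U j y -> label y t = j -> s \in chosen (label y) j.+1.
  by rewrite inE => /and3P[st _ nc] tj; apply: sampled_chosen st; rewrite inE tj eqxx.
have hitsE j y : #|[set t in sampled (label y) j | (s, t) \in E]|%:R = hits R beta V j y.
  congr _%:R; rewrite -(card_imset _ pos_inj); apply: eq_card => i; rewrite [RHS]inE.
  apply/imsetP/andP => [[t]|[/imsetP[t]]].
    rewrite !inE => /andP[/andP[/eqP tj nc] st] ->; rewrite -[beta _]/(label y t) tj eqxx; split=> //.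
    by apply: imset_f; rewrite inE st -{1}tj leqnn nc.
  rewrite inE => /and3P[st _ nc] -> tj; exists t => //.
  by rewrite !inE st nc tj.
rewrite (eq_bigr (fun y => \sum_(j < L) hits R beta V j y)); last first.
  by move=> y _; apply: eq_bigr => j _; apply: hitsE.
apply: le_trans (@sum_hits _ _ _ _ V A A_ge0 bucket_growth _ _ _ _ L) _.
(* The four hypotheses on [V] follow in order: adapted, late, decreasing, emptied by a hit. *)
- move=> j y y' yy'; have eq_label t :
    (label y t < j)%N || (label y' t < j)%N -> label y t = label y' t.
    by move=> /yy' E1; rewrite /label E1.
  suff UU : U j y = U j y' by rewrite /V UU.
  apply/setP => t; rewrite !inE (chosen_adapted eq_label).
  have := eq_label t; case: (leqP j (label y t)) => [le|lt] //=.
    by case: (leqP j (label y' t)) => // lt' /(_ isT) E1; rewrite E1 leqNgt lt' in le.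
  by move=> /(_ isT) <-; rewrite leqNgt lt.
- by move=> j y i /imsetP[t]; rewrite inE => /and3P[_ le _] ->.
- move=> j y; apply: imsetS; apply/subsetP => t; rewrite !inE => /and3P[-> le nc].
  rewrite ltnW //=; apply: contraNN nc; apply: covered_sub; exact: chosen_sub.
- move=> j y i /imsetP[t tU ->] tj; have sC := chosen_hit _ _ _ tU tj.
  apply/eqP; rewrite imset_eq0 -subset0; apply/subsetP => t'; rewrite !inE => /and3P[st' _ nc].
  by case/negP: nc; apply/exists_inP; exists s.
(* It remains to bound the initial potential: [V 0] has at most [nT] coordinates, and [tail 0]
   counts all words. *)
rewrite mulr_natr -sumr_const; apply: ler_sum => y _; apply: le_trans kappa_ge.
have -> : #|W|%:R = #|[set w | (0 <= beta w)%N]|%:R :> R.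
  by congr _%:R; apply: eq_card => w; rewrite !inE.
rewrite /potential; case: ifP => _; first by rewrite addr_ge0 // mulr_ge0 ?divr_ge0 ?ler0n.
rewrite lerD2l ler_wpM2r ?divr_ge0 ?ler0n // ler_nat.
by rewrite (card_imset _ pos_inj) (leq_trans (max_card _)) // card_ord.
Qed.

Lemma sum_card_chosen C f L : is_cover E C ->
  (forall t, (#|sets_containing E t| <= f)%N) ->
  \sum_y #|chosen (label y) L|%:R <=
    kappa * f%:R * #|C|%:R * #|{: {ffun I -> W}}|%:R.
Proof.
move=> cov hf.
apply: le_trans (_ : f%:R * \sum_(s in C) (kappa * #|{: {ffun I -> W}}|%:R) <= _); last first.
  by rewrite sumr_const -[X in _ * X]mulr_natr le_eqVlt; apply/orP; left; apply/eqP; ring.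
(* A sampled element costs at most [f] sets and is charged to the sets of [C] containing it, of
   which there is at least one. *)
apply: le_trans (_ : f%:R * \sum_(s in C) \sum_y \sum_(j < L)
   #|[set t in sampled (label y) j | (s, t) \in E]|%:R <= _); last first.
  by rewrite ler_wpM2l ?ler0n //; apply: ler_sum => s _; apply: sum_sampled_in_set.
rewrite exchange_big mulr_sumr; apply: ler_sum => y _ /=; rewrite exchange_big /=.
apply: le_trans (_ : (f * \sum_(j < L) #|sampled (label y) j|)%:R <= _).
  by rewrite ler_nat card_chosen.
rewrite natrM ler_wpM2l ?ler0n // natr_sum; apply: ler_sum => j _.
by rewrite -natr_sum ler_nat card_sampled.
Qed.

End Expectation.
End Rounds.

(** * Buckets of random times *)

Section Buckets.
Variable q : nat.
Hypothesis q_gt0 : 0 < q.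

Fixpoint width j := if j is j'.+1 then width j' + width j' %/ q else q.
Fixpoint start j := if j is j'.+1 then start j' + width j' else 0.

Lemma width_ge j : q <= width j.
Proof. by elim: j => //= j IH; rewrite (leq_trans IH) ?leq_addr. Qed.

Lemma width_growth j : q * width j.+1 <= q.+1 * width j.
Proof. by rewrite /= mulnDr mulSn addnC leq_add2r mulnC leq_trunc_div. Qed.

Lemma start_ge j : j <= start j.
Proof. by elim: j => //= j IH; rewrite -addn1 leq_add // (leq_trans q_gt0) ?width_ge. Qed.

Lemma leq_start : {homo start : i j / i <= j}.
Proof. by move=> i j /subnKC <-; elim: (j - i) => [|k IH]; rewrite ?addn0 // addnS (leq_trans IH) ?leq_addr. Qed.

Lemma start_inj i j x : start i <= x < start i.+1 -> start j <= x < start j.+1 -> i = j.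
Proof.
move=> /andP[h1 h2] /andP[h3 h4]; case: (ltngtP i j) => // /leq_start lt.
  by move: (leq_trans h2 lt); rewrite ltnNge h3.
by move: (leq_trans h4 lt); rewrite ltnNge h1.
Qed.

Definition bucket_of x := find (fun j => x < start j.+1) (iota 0 x.+1).

Lemma bucket_ofP x : start (bucket_of x) <= x < start (bucket_of x).+1.
Proof.
have h : has (fun j => x < start j.+1) (iota 0 x.+1).
  by apply/hasP; exists x; rewrite ?mem_iota ?add0n //=; apply: (start_ge x.+1).
have lt : bucket_of x < x.+1 by rewrite has_find size_iota in h.
have := nth_find 0 h; rewrite -/(bucket_of x) nth_iota // add0n => ->; rewrite andbT.
case E : (bucket_of x) => [//|j].
have : j < find (fun j => x < start j.+1) (iota 0 x.+1) by rewrite -/(bucket_of x) E.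
move/(before_find 0); rewrite nth_iota ?add0n; last by rewrite E in lt; apply: ltnW.
by move/negbT; rewrite -leqNgt.
Qed.

Lemma bucket_ofE j x : start j <= x < start j.+1 -> bucket_of x = j.
Proof. by move=> h; apply: start_inj (bucket_ofP x) h. Qed.

Lemma bucket_of_lt j x : (bucket_of x < j) = (x < start j).
Proof.
have /andP[h1 h2] := bucket_ofP x; apply/idP/idP => [lt|].
  by apply: leq_trans h2 _; apply: leq_start.
by apply: contraLR; rewrite -!leqNgt => /leq_start /leq_trans -> .
Qed.

Lemma width_start j : width j <= q + start j.
Proof.
elim: j => [|j IH] /=; first by rewrite addn0.
by rewrite addnA leq_add // leq_div.
Qed.

Lemma start_expn j : q + start j <= q * 2 ^ j.
Proof.
elim: j => [|j IH] /=; first by rewrite addn0 muln1.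
rewrite expnS mulnCA mul2n -addnn addnA leq_add //.
exact: leq_trans (width_start j) IH.
Qed.

Lemma leq_width : {homo width : i j / i <= j}.
Proof. by move=> i j /subnKC <-; elim: (j - i) => [|k IH]; rewrite ?addn0 // addnS (leq_trans IH) ?leq_addr. Qed.

Lemma width_linear j k : width j + k * (width j %/ q) <= width (j + k).
Proof.
elim: k => [|k IH]; first by rewrite mul0n !addn0.
rewrite addnS mulSnr addnA /= leq_add // leq_div2r //.
by apply: leq_width; apply: leq_addr.
Qed.

(** The width doubles within [2 * q] steps: each adds at least [width %/ q], and rounding down loses
    at most half of the quotient because the width is at least [q]. *)
Lemma width_expn k : 2 ^ k <= width (2 * q * k).
Proof.
elim: k => [|k IH]; first by rewrite muln0.
rewrite mulnS addnC; apply: leq_trans (width_linear _ _).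
rewrite expnS mul2n -addnn leq_add //; apply: leq_trans IH _.
have := width_ge (2 * q * k); set h := width _ => hq.
have := divn_eq h q; have := ltn_pmod h q_gt0.
have : 0 < h %/ q by rewrite divn_gt0.
by nia.
Qed.

Lemma start_expn_lt k : 2 ^ k <= start (2 * q * k).+1.
Proof. by apply: leq_trans (width_expn k) _; rewrite /= leq_addl. Qed.

(** * Bucket sizes for uniform words reduced modulo [N] *)

Section Weights.
Variables (M N : nat).
Hypothesis N_gt0 : 0 < N.
Let a := M %/ N.
Let weight j := #|[set w : 'I_M | bucket_of (w %% N) == j]|.

(** A word is its quotient and remainder modulo [N]; at most [a.+1] quotients occur, the last
    possibly from an incomplete period. *)
Lemma weight_ub j : weight j <= a.+1 * width j.
Proof.
have wj : width j = (width j).-1.+1 by rewrite prednK // (leq_trans q_gt0) ?width_ge.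
pose g (w : 'I_M) : 'I_a.+1 * 'I_(width j).-1.+1 := (inord (w %/ N), inord (w %% N - start j)).
rewrite wj -[a.+1]card_ord -[X in _ * X]card_ord -card_prod.
rewrite /weight -(card_in_imset (f := g)); first exact: max_card.
move=> w w'; rewrite !inE => /eqP hw /eqP hw' [] /(congr1 val) /= e1 /(congr1 val) /= e2.
have := bucket_ofP (w %% N); have := bucket_ofP (w' %% N); rewrite hw hw' /= => b' b.
move: e1; rewrite !inordK ?ltnS ?leq_div2r 1?ltnW // => e1.
move: e2; rewrite !inordK -?wj; [move=> e2|lia|lia].
apply: val_inj; rewrite /= (divn_eq w N) (divn_eq w' N) e1; congr (_ + _); lia.
Qed.

(** Counts only the [a] complete periods, each of which contains the whole bucket when it ends by
    [N]. *)
Lemma weight_lb j : start j.+1 <= N -> a * width j <= weight j.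
Proof.
move=> le; have lt (p : 'I_a * 'I_(width j)) : p.1 * N + (start j + p.2) < M.
  have aM : a * N <= M by rewrite leq_trunc_div.
  case: p => [[x xa] [z zw]] /=; rewrite /= in le; nia.
pose g p := Ordinal (lt p).
rewrite -[a]card_ord -[width j]card_ord -card_prod -(card_imset _ (f := g)); last first.
  move=> p p' /(congr1 val) /= H.
  have b (p0 : 'I_a * 'I_(width j)) : start j + p0.2 < N.
    by apply: leq_trans le; rewrite /= ltn_add2l.
  have := congr1 (divn^~ N) H; have := congr1 (modn^~ N) H.
  rewrite /= !modnMDl !divnMDl // !modn_small ?b // !divn_small ?b // !addn0 => /addnI e2 e1.
  by case: p p' e1 e2 {H} => [x z] [x' z'] /= /val_inj -> /val_inj ->.
apply: subset_leq_card; apply/subsetP => w /imsetP[[x z] _ ->]; rewrite inE /= modnMDl.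
have b : start j + z < N by apply: leq_trans le; rewrite /= ltn_add2l.
rewrite modn_small //; apply/eqP/bucket_ofE; by rewrite leq_addr /= ltn_add2l ltn_ord.
Qed.

(** One factor [(q + 1) / q] is for the growth of the widths, the other for the incomplete period,
    since [(a + 1) / a] is no larger when [q <= a]. *)
Lemma weight_growth j : q <= a -> q ^ 2 * weight j.+1 <= q.+1 ^ 2 * weight j.
Proof.
move=> qa; case: (posnP (weight j.+1)) => [->|]; first by rewrite muln0.
(* A word in bucket [j.+1] shows that bucket [j] ends by [N], so [weight_lb] applies to it. *)
rewrite card_gt0 => /set0Pn[w]; rewrite inE => /eqP hw.
have := bucket_ofP (w %% N); rewrite hw => /andP[h _].
have le := leq_trans h (ltnW (ltn_pmod w N_gt0)).
have ub := weight_ub j.+1; have lb := weight_lb le; have gr := width_growth j.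
have a0 : 0 < a by apply: leq_trans qa.
rewrite -(leq_pmul2l a0).
have h1 : q ^ 2 * weight j.+1 <= q ^ 2 * (a.+1 * width j.+1) by rewrite leq_mul2l ub orbT.
have h2 : q.+1 ^ 2 * (a * width j) <= q.+1 ^ 2 * weight j by rewrite leq_mul2l lb orbT.
have h3 : a.+1 * q <= q.+1 * a by nia.
have h4 : (a.+1 * q) * (q * width j.+1) <= (q.+1 * a) * (q.+1 * width j) by apply: leq_mul.
have h5 : a * (q ^ 2 * weight j.+1) <= a * (q ^ 2 * (a.+1 * width j.+1)) by rewrite leq_mul2l h1 orbT.
have h6 : a * (q.+1 ^ 2 * (a * width j)) <= a * (q.+1 ^ 2 * weight j) by rewrite leq_mul2l h2 orbT.
apply: leq_trans h5 _; apply: leq_trans _ h6; rewrite leq_mul2l; apply/orP; right.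
rewrite -!mulnn; move: h4; lia.
Qed.

Lemma weight0_bound k : 0 < a -> q ^ 2 * k <= N -> k * weight 0 * q <= 2 * M.
Proof.
move=> a0 kN; have ub := weight_ub 0; rewrite /= in ub.
have aM : a * N <= M by rewrite leq_trunc_div.
have h1 : k * weight 0 * q <= k * (a.+1 * q) * q by rewrite leq_mul2r leq_mul2l ub !orbT.
have h2 : a.+1 * (q ^ 2 * k) <= (2 * a) * N by apply: leq_mul => //; lia.
have h3 : 2 * (a * N) <= 2 * M by rewrite leq_mul2l.
apply: leq_trans h1 _; apply: leq_trans h3; rewrite -mulnn in h2; lia.
Qed.
End Weights.
End Buckets.

(** * Running programs without overflow *)

(* [eval] without the reduction of intermediate results modulo 2 ^ w. *)
Fixpoint value (m : nat -> nat) (i : nat) (e : expr) : nat :=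
  match e with
  | Cst c => c
  | Pid => i
  | Rnd => 0
  | Read e1 => m (value m i e1)
  | Bin o e1 e2 => binop_sem o (value m i e1) (value m i e2)
  | Ite e1 e2 e3 => if value m i e1 != 0 then value m i e2 else value m i e3
  end.

(** Excluding [Rnd] and large constants makes one number [B] bound every leaf of the expression. *)
Fixpoint plain (q : nat) (e : expr) : bool :=
  match e with
  | Cst c => (c <= 16) || (c == q)
  | Pid => true
  | Rnd => false
  | Read e1 => plain q e1
  | Bin _ e1 e2 => plain q e1 && plain q e2
  | Ite e1 e2 e3 => [&& plain q e1, plain q e2 & plain q e3]
  end.

(** Multiplication grows fastest: operands at most [B ^ a] and [B ^ b] give at most [B ^ (a + b)],
    and the further factor [B] for the node absorbs sums. Hence no reduction modulo [2 ^ w] takes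
    effect. *)
Lemma eval_value w q B m i r e : 16 <= B -> q <= B -> (forall x, m x <= B) -> i <= B ->
  plain q e -> B ^ cost e < 2 ^ w ->
  eval w m i r e = value m i e /\ value m i e <= B ^ cost e.
Proof.
move=> B16 qB mB iB.
have B0 : 0 < B by apply: leq_trans B16.
have mono a b : a <= b -> B ^ a <= B ^ b by apply: leq_pexp2l.
elim: e => [c|||e1 IH|o e1 IH1 e2 IH2|e1 IH1 e2 IH2 e3 IH3] //=.
- move=> cB; rewrite expn1 => Bw.
  have le : c <= B by case/orP: cB => [|/eqP -> //]; lia.
  by rewrite modn_small //; apply: leq_ltn_trans Bw.
- by rewrite expn1 => _ Bw; rewrite modn_small //; apply: leq_ltn_trans Bw.
- move=> p Bw; have [|-> h] := IH p; first by apply: leq_ltn_trans Bw; apply: mono.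
  have h2 : m (value m i e1) <= B ^ (cost e1).+1.
    by apply: leq_trans (mB _) _; rewrite -{1}(expn1 B); apply: mono.
  by rewrite modn_small //; apply: leq_ltn_trans Bw.
- move=> /andP[p1 p2] Bw.
  have [|-> h1] := IH1 p1; first by apply: leq_ltn_trans Bw; apply: mono; rewrite ltnW // ltnS leq_addr.
  have [|-> h2] := IH2 p2; first by apply: leq_ltn_trans Bw; apply: mono; rewrite ltnW // ltnS leq_addl.
  set x := value m i e1 in h1 *; set y := value m i e2 in h2 *.
  suff h3 : binop_sem o x y <= B ^ (cost e1 + cost e2).+1.
    by rewrite modn_small //; apply: leq_ltn_trans Bw.
  have X0 : 0 < B ^ cost e1 by rewrite expn_gt0 B0.
  have Y0 : 0 < B ^ cost e2 by rewrite expn_gt0 B0.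
  rewrite expnS expnD; set X := B ^ cost e1 in h1 X0 *; set Y := B ^ cost e2 in h2 Y0 *.
  have hx : X <= X * Y by rewrite leq_pmulr.
  have hy : Y <= X * Y by rewrite leq_pmull.
  have hB : 16 * (X * Y) <= B * (X * Y) by rewrite leq_mul2r B16 orbT.
  case: o => /=.
  + lia.
  + lia.
  + have := leq_mul h1 h2; lia.
  + have := leq_div x y; lia.
  + have := leq_mod x y; lia.
  + case: eqP; lia.
  + case: ltnP; lia.
- move=> /and3P[p1 p2 p3] Bw.
  have [|-> h1] := IH1 p1; first by apply: leq_ltn_trans Bw; apply: mono; lia.
  have [|-> h2] := IH2 p2; first by apply: leq_ltn_trans Bw; apply: mono; lia.
  have [|-> h3] := IH3 p3; first by apply: leq_ltn_trans Bw; apply: mono; lia.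
  have h4 : (if value m i e1 != 0 then value m i e2 else value m i e3) <= B ^ (cost e1 + cost e2 + cost e3).+1.
    by case: ifP => _; [apply: leq_trans h2 _|apply: leq_trans h3 _]; apply: mono; lia.
  by rewrite modn_small //; apply: leq_ltn_trans Bw.
Qed.

(** The rule for reasoning against the adversary: whoever wins is one of the competing writers, so
    [P] is required of each of them. *)
Lemma par_write_elim w D K (om : tape w D K) rho s k g a v x (P : nat -> Prop) :
  let E i e := eval w (memory s) i (draw om (depth s) i) e in
  (forall i, i < k -> E i g != 0 -> E i a = x -> P (E i v)) ->
  ((forall i, i < k -> E i g != 0 -> E i a <> x) -> P (memory s x)) ->
  P (par_write om rho s k g a v x).
Proof.
move=> E hw hu; rewrite /par_write; set ws := writers _ _ _ _ _ _.
have wsP i : (i \in ws) = [&& i < k, E i g != 0 & E i a == x].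
  by rewrite mem_filter mem_iota andbC.
case W : ws => [|i0 ws'].
  by apply: hu => i ik gi ai; have := wsP i; rewrite W in_nil ik gi ai eqxx.
rewrite -W; have : nth 0 ws (rho (depth s) x %% size ws) \in ws.
  by apply: mem_nth; rewrite ltn_mod W.
by rewrite wsP => /and3P[ik gi /eqP ai]; apply: hw.
Qed.

Definition no_cells : nat -> nat := fun=> 0.

Definition Qexpr : expr :=
  Bin OAdd (Bin OAdd (Cst 3) (Bin OMul (Cst 2) (Read (Cst 2)))) (Read (Cst 0)).
Definition addr (j : nat) (e : expr) : expr :=
  Bin OAdd Qexpr (Bin OAdd (Cst j) (Bin OMul (Cst 16) e)).
Definition Arr (j : nat) (e : expr) : expr := Read (addr j e).

(* Any bound on the cost of the expressions of the program would do: together with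
   a bound B on all stored words, it gives the word size needed by [eval_value]. *)
Definition max_cost : nat := 400.
Definition admissible (q : nat) (e : expr) : bool := plain q e && (cost e <= max_cost).
Definition step_cost : nat := 4 * max_cost + 1.
Arguments max_cost : simpl never.
Arguments step_cost : simpl never.

(** * Memory layout and rules for program runs *)

Section Layout.
Variables (nS m : nat) (input : seq nat).

(* Cell x of array j, for j < 16, is stored at address Qbase + j + 16 x, beyond the
   input and the output; interleaved arrays cannot overlap, whatever their sizes. *)
Definition Qbase : nat := 3 + 2 * m + nS.

Definition layout (l : seq (nat -> nat)) (x : nat) : nat :=
  if x < Qbase then nth 0 input x else nth no_cells l ((x - Qbase) %% 16) ((x - Qbase) %/ 16).

Lemma layout_low l x : x < Qbase -> layout l x = nth 0 input x.
Proof. by rewrite /layout => ->. Qed.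

Lemma layout_array l j x : j < 16 -> layout l (Qbase + (j + 16 * x)) = nth no_cells l j x.
Proof.
move=> j16; rewrite /layout ltnNge leq_addr /= addKn addnC mulnC modnMDl divnMDl //.
by rewrite modn_small // divn_small // addn0.
Qed.

Section Runs.
Variables (w D K : nat) (om : tape w D K) (rho : nat -> nat -> nat) (q B : nat).
Definition bounded (l : seq (nat -> nat)) := forall j x, nth no_cells l j x <= B.

(** A Hoare triple with budgets for depth and work; the counters of the start state are arbitrary,
    so budgets add under sequencing. *)
Definition runs p l l' (d k : nat) := forall s, memory s =1 layout l -> bounded l ->
  exists s', [/\ exec om rho p s s', memory s' =1 layout l', bounded l',
    depth s' <= depth s + d & work s' <= work s + k].

Lemma runs_ext p l l1 l' l2 d k : runs p l1 l2 d k ->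
  (forall j x, nth no_cells l j x = nth no_cells l1 j x) ->
  (forall j x, nth no_cells l2 j x = nth no_cells l' j x) -> runs p l l' d k.
Proof.
move=> r ll1 l2l' s ms bl; have [|j x|s' [e ms' b' ds ws]] := r s.
- by move=> x; rewrite ms /layout ll1.
- by rewrite -ll1.
exists s'; split => //; first by move=> x; rewrite ms' /layout l2l'.
by move=> j x; rewrite -l2l'.
Qed.

Lemma runs_leq p l l' d d' k k' : runs p l l' d' k' -> d' <= d -> k' <= k -> runs p l l' d k.
Proof.
by move=> r dd kk s ms bl; have [s' [e ms' b' ds ws]] := r s ms bl; exists s'; split => //; lia.
Qed.

Lemma runs_seq p p' l l1 l2 d1 d2 k1 k2 :
  runs p l l1 d1 k1 -> runs p' l1 l2 d2 k2 -> runs (Seq p p') l l2 (d1 + d2) (k1 + k2).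
Proof.
move=> r1 r2 s ms bl; have [s1 [e1 m1 b1 h1 h1']] := r1 s ms bl.
have [s2 [e2 m2 b2 h2 h2']] := r2 s1 m1 b1.
by exists s2; split => //; [apply: exec_seq e1 e2|lia|lia].
Qed.

Hypothesis inp0 : nth 0 input 0 = nS.
Hypothesis inp2 : nth 0 input 2 = m.

Lemma value_addr l i j e : value (layout l) i (addr j e) = Qbase + (j + 16 * value (layout l) i e).
Proof. by rewrite /= !layout_low ?inp0 ?inp2. Qed.

Lemma value_Arr l i j e : j < 16 -> value (layout l) i (Arr j e) = nth no_cells l j (value (layout l) i e).
Proof. by move=> j16; rewrite -layout_array // -(value_addr l i). Qed.

Hypothesis B16 : 16 <= B.
Hypothesis qB : q <= B.
Hypothesis Bw : B ^ max_cost < 2 ^ w.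
Hypothesis inpB : forall x, nth 0 input x <= B.

Lemma bounded_layout l : bounded l -> forall x, layout l x <= B.
Proof. by move=> bl x; rewrite /layout; case: ifP. Qed.

Lemma eval_layout l mem i r e : mem =1 layout l -> bounded l -> i <= B -> admissible q e ->
  eval w mem i r e = value (layout l) i e.
Proof.
move=> ml bl iB /andP[pe ce].
have EE : value mem i e = value (layout l) i e.
  elim: e {pe ce} => //= [e1 ->|o e1 -> e2 ->|e1 -> e2 -> e3 ->] //.
have h x : mem x <= B by rewrite ml; apply: bounded_layout.
have h2 : B ^ cost e < 2 ^ w.
  by apply: leq_ltn_trans Bw; rewrite leq_pexp2l // (leq_trans _ B16).
by have [-> _] := eval_value r B16 qB h iB pe h2.
Qed.

Lemma runs_while e p (st : nat -> seq (nat -> nat)) n d (k : nat -> nat) :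
  admissible q e ->
  (forall u, u < n -> value (layout (st u)) 0 e != 0) -> value (layout (st n)) 0 e = 0 ->
  (forall u, u < n -> runs p (st u) (st u.+1) d (k u)) ->
  runs (While e p) (st 0) (st n) (n * (max_cost + d) + max_cost)
    (\sum_(u < n) (max_cost + k u) + max_cost).
Proof.
move=> ge e1 e0 body.
suff H c u : u + c = n -> runs (While e p) (st u) (st n) (c * (max_cost + d) + max_cost)
    (\sum_(u <= i < n) (max_cost + k i) + max_cost).
  by have := H n 0 (add0n n); rewrite big_mkord.
have ce : cost e <= max_cost by case/andP: ge.
elim: c u => [|c IH] u uc s ms bl.
  rewrite addn0 in uc; subst u; exists (charge s (cost e) (cost e)); split => //=; try lia.
  by apply: exec_while_false; rewrite /eval0 (eval_layout _ ms bl).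
have un : u < n by lia.
have [|s1 [x1 m1 b1 h1 h1']] := body u un (charge s (cost e) (cost e)) _ bl; first by [].
have [|s2 [x2 m2 b2 h2 h2']] := IH u.+1 _ s1 m1 b1; first by lia.
exists s2; split => //.
- by apply: exec_while_true x1 x2; rewrite /eval0 (eval_layout _ ms bl) // e1.
- by move: h1 h2; rewrite /= mulSn; lia.
- by move: h1' h2'; rewrite /= [in X in _ -> _ -> _ <= _ + X]big_ltn //; lia.
Qed.

(** The array after the instruction is one function [newv] to which every active write conforms, so
    competing writers agree and [rho] disappears. *)
Lemma runs_pardo j k g e v l l' newv n :
  j < 16 -> admissible q k -> admissible q g -> admissible q (addr j e) -> admissible q v ->
  value (layout l) 0 k = n -> n <= B -> (forall x, newv x <= B) ->
  (forall i, i < n -> value (layout l) i g != 0 -> value (layout l) i v = newv (value (layout l) i e)) ->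
  (forall x, (forall i, i < n -> value (layout l) i g != 0 -> value (layout l) i e <> x) ->
     newv x = nth no_cells l j x) ->
  set_nth no_cells l j newv = l' ->
  runs (Pardo k g (addr j e) v) l l' step_cost (step_cost * n.+1).
Proof.
move=> j16 gk gg ga gv kn nB newB hw hu <- s ms bl.
have [ck cg ca cv] : [/\ cost k <= max_cost, cost g <= max_cost,
    cost (addr j e) <= max_cost & cost v <= max_cost].
  by move: gk gg ga gv => /andP[_ ->] /andP[_ ->] /andP[_ ->] /andP[_ ->].
have Ek : eval0 om s k = n by rewrite /eval0 (eval_layout _ ms bl).
eexists; split; first by apply: exec_pardo.
- have ev_i i r e' : i < n -> admissible q e' -> eval w (memory s) i r e' = value (layout l) i e'.
    by move=> lt ge; apply: eval_layout => //; lia.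
  rewrite Ek => x; apply: (@par_write_elim _ _ _ om rho (charge s (cost k) (cost k)) n g (addr j e) v x
    (fun y => y = layout (set_nth no_cells l j newv) x)) => [i lt|hx].
    rewrite !ev_i // value_addr => gi <-; rewrite layout_array // nth_set_nth /= eqxx; exact: hw.
  rewrite ms /layout; case: ltnP => // Qx; rewrite nth_set_nth /=; case: eqP => // jx.
  rewrite hu ?jx // => i lt gi ex; apply: (hx i lt); rewrite ?ev_i // value_addr ex.
  by have := divn_eq (x - Qbase) 16; lia.
- by move=> j' x; rewrite nth_set_nth /=; case: eqP.
- by rewrite /step_cost /pardo; move: (cost (addr j e)) max_cost ck cg ca cv => c mc /= ck cg ca cv; lia.
rewrite Ek /step_cost /pardo; move: (cost (addr j e)) max_cost ck cg ca cv => c mc /= ck cg ca cv.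
have : n * (cost g + c + cost v).+1 <= n * (3 * mc + 1) by rewrite leq_mul2l; lia.
lia.
Qed.

Definition scalar (v x : nat) : nat := if x is 0 then v else 0.

Lemma runs_assign j v l l' c : j < 16 -> admissible q v ->
  value (layout l) 0 v = c -> c <= B -> (forall x, x != 0 -> nth no_cells l j x = 0) ->
  set_nth no_cells l j (scalar c) = l' ->
  runs (Pardo (Cst 1) (Cst 1) (addr j (Cst 0)) v) l l'
    step_cost (step_cost * 2).
Proof.
move=> j16 gv vc cB hl <-; apply: (@runs_pardo _ _ _ _ _ _ _ (scalar c) 1) => //=; try lia.
- by rewrite /admissible /=; case: (j <= 16) (ltnW j16).
- by case=> [|x].
- by case=> // _ _; rewrite vc.
- by case=> [/(_ 0 isT isT)|x _] //; rewrite hl.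
Qed.

End Runs.
End Layout.

(** * The program *)

(* The arrays of the program (a scalar is cell 0 of its array):
   0: times of the elements       1: loop counter         2, 3: start and width of a bucket
   4: bucket of each time         5: L                    6: G
   7: counters, that of bucket i and class j at i G + j
   8: rank of an edge among the edges of its counter
   9: sum of the preceding counters of the same block
   10: sums of blocks, block b at index b + 1, so that cell 0 stays 0
   11: window length, then first slot of the current bucket
   12: sorted edges, e stored as e + 1 and 0 for no edge
   13: elements found covered     14: chosen sets *)

Section Program.
Variable q : nat.

Definition Var (j : nat) : expr := Arr j (Cst 0).
Definition Assign (j : nat) (v : expr) : cmd := Pardo (Cst 1) (Cst 1) (addr j (Cst 0)) v.
Definition Src (e : expr) : expr := Read (Bin OAdd (Cst 3) (Bin OMul (Cst 2) e)).
Definition Tgt (e : expr) : expr := Read (Bin OAdd (Cst 4) (Bin OMul (Cst 2) e)).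
Definition Nexpr : expr :=
  Bin OMul (Bin OMul (Cst q) (Cst q))
    (Bin OAdd (Bin OAdd (Read (Cst 0)) (Read (Cst 1))) (Cst 1)).

Definition draw_times : cmd :=
  Pardo (Read (Cst 1)) (Cst 1) (addr 0 Pid) (Bin OMod Rnd Nexpr).

Definition fill_table : cmd :=
  Seq (Assign 3 (Cst q))
    (While (Bin OLtb (Var 2) Nexpr)
      (Seq (Pardo (Var 3) (Cst 1) (addr 4 (Bin OAdd (Var 2) Pid)) (Var 1))
      (Seq (Assign 2 (Bin OAdd (Var 2) (Var 3)))
      (Seq (Assign 3 (Bin OAdd (Var 3) (Bin ODiv (Var 3) (Cst q))))
           (Assign 1 (Bin OAdd (Var 1) (Cst 1))))))).
Definition set_sizes : cmd :=
  Seq (Assign 5 (Var 1))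
  (Seq (Assign 6 (Bin OAdd (Bin ODiv (Read (Cst 2)) (Var 5)) (Cst 1)))
       (Assign 1 (Cst 0))).

Definition Bucket (e : expr) : expr := Arr 4 (Arr 0 (Tgt e)).
(** Array 6 holds [G]: the edges of a class are [G] apart, and processor [Pid] treats class [Pid],
    one edge per step. *)
Definition Edge : expr := Bin OAdd (Bin OMul (Var 1) (Var 6)) Pid.
Definition Cell (e j : expr) : expr := Bin OAdd (Bin OMul (Bucket e) (Var 6)) j.
Definition Less (i : expr) : expr := Bin OLtb i (Var 5).
Definition Incr : cmd := Assign 1 (Bin OAdd (Var 1) (Cst 1)).

Definition count_cells : cmd :=
  While (Less (Var 1))
    (Seq (Pardo (Var 6) (Bin OLtb Edge (Read (Cst 2))) (addr 8 Edge) (Arr 7 (Cell Edge Pid)))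
    (Seq (Pardo (Var 6) (Bin OLtb Edge (Read (Cst 2))) (addr 7 (Cell Edge Pid))
            (Bin OAdd (Arr 7 (Cell Edge Pid)) (Cst 1)))
         Incr)).

Definition Slot : expr := Bin OAdd (Bin OMul Pid (Var 5)) (Var 1).
Definition Next : expr := Bin OAdd Pid (Cst 1).

Definition scan_blocks : cmd :=
  Seq (Assign 1 (Cst 0))
    (While (Less (Var 1))
      (Seq (Pardo (Var 6) (Cst 1) (addr 9 Slot) (Arr 10 Next))
      (Seq (Pardo (Var 6) (Cst 1) (addr 10 Next) (Bin OAdd (Arr 10 Next) (Arr 7 Slot)))
           Incr))).

Definition scan_sums : cmd :=
  Seq (Assign 11 (Cst 1))
    (While (Bin OLtb (Var 11) (Var 6))
      (Seq (Pardo (Var 6) (Cst 1) (addr 10 Next)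
              (Bin OAdd (Arr 10 Next) (Arr 10 (Bin OSub Next (Var 11)))))
           (Assign 11 (Bin OAdd (Var 11) (Var 11))))).

Definition Prefix (z : expr) : expr := Bin OAdd (Arr 9 z) (Arr 10 (Bin ODiv z (Var 5))).

Definition sort_edges : cmd :=
  Pardo (Read (Cst 2)) (Cst 1)
    (addr 12 (Bin OAdd (Prefix (Cell Pid (Bin OMod Pid (Var 6)))) (Arr 8 Pid)))
    (Bin OAdd Pid (Cst 1)).

Definition Entry : expr := Arr 12 (Bin OAdd (Var 11) Pid).
Definition CurEdge : expr := Bin OSub Entry (Cst 1).
Definition Range : expr :=
  Bin OSub (Prefix (Bin OMul (Bin OAdd (Var 1) (Cst 1)) (Var 6))) (Var 11).
(** The guard itself checks that the slot holds an edge of the current bucket, so correctness asks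
    of [Range] only that it reaches all such edges. *)
Definition Current (g : expr) : expr :=
  Ite Entry (Ite (Bin OEqb (Bucket CurEdge) (Var 1)) g (Cst 0)) (Cst 0).

(** Two passes over the same slots: coverage by earlier rounds must be recorded before new sets are
    chosen. *)
Definition rounds : cmd :=
  Seq (Assign 1 (Cst 0))
    (While (Less (Var 1))
      (Seq (Assign 11 (Prefix (Bin OMul (Var 1) (Var 6))))
      (Seq (Pardo Range (Current (Arr 14 (Src CurEdge))) (addr 13 (Tgt CurEdge)) (Cst 1))
      (Seq (Pardo Range (Current (Bin OEqb (Arr 13 (Tgt CurEdge)) (Cst 0)))
              (addr 14 (Src CurEdge)) (Cst 1))
           Incr)))).

Definition write_output : cmd :=
  Pardo (Read (Cst 0)) (Cst 1)
    (Bin OAdd (Bin OAdd (Cst 3) (Bin OMul (Cst 2) (Read (Cst 2)))) Pid) (Arr 14 Pid).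

(** The two outer instructions are kept apart from the rules for [runs]: [draw_times] uses [Rnd],
    and [write_output] writes below the arrays. *)
Definition main : cmd :=
  Seq fill_table (Seq set_sizes (Seq count_cells (Seq scan_blocks
    (Seq scan_sums (Seq sort_edges rounds))))).

Definition program : cmd := Seq draw_times (Seq main write_output).

End Program.

Ltac solve_admissible :=
  rewrite /admissible /Less /Edge /Cell /Bucket /Slot /Next /Entry /CurEdge /Range /Current
    /Prefix /Nexpr /Var /Src /Tgt /Arr /addr /Qexpr /= ?eqxx ?orbT //.

(** * Correctness and cost of each phase *)

Section Phases.
Variables (nS nT m q B : nat) (input : seq nat).
Hypothesis size_inp : size input = 3 + 2 * m.
Hypothesis inp0 : nth 0 input 0 = nS.
Hypothesis inp1 : nth 0 input 1 = nT.
Hypothesis inp2 : nth 0 input 2 = m.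
Variables (w D K : nat) (om : tape w D K) (rho : nat -> nat -> nat).
Hypothesis B16 : 16 <= B.
Hypothesis q_gt0 : 0 < q.
Hypothesis Bw : B ^ max_cost < 2 ^ w.
Hypothesis inpB : forall x, nth 0 input x <= B.
Let N := q * q * (nS + nT + 1).
Hypothesis hB : 10 * (N + m + 1) <= B.

Let qN : q <= N.
Proof. by rewrite /N; nia. Qed.
Let qB : q <= B.
Proof. by move: qN hB; lia. Qed.

Local Notation run := (runs nS m input om rho B).

Let evE := value_Arr inp0 inp2.
Let run_pardo := runs_pardo om rho inp0 inp2 B16 qB Bw inpB.
Let run_assign := runs_assign om rho inp0 inp2 B16 qB Bw inpB.
Let run_while := @runs_while nS m input w D K om rho q B inp0 inp2 B16 qB Bw inpB.

Let ev_N l i : value (layout nS m input l) i (Nexpr q) = N.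
Proof. by rewrite /Nexpr /= !layout_low ?inp0 ?inp1. Qed.

Let ev_cst mm i c : value mm i (Cst c) = c. Proof. by []. Qed.
Let ev_pid mm i : value mm i Pid = i. Proof. by []. Qed.
Let ev_bin mm i o e1 e2 :
  value mm i (Bin o e1 e2) = binop_sem o (value mm i e1) (value mm i e2). Proof. by []. Qed.
Let ev_ite mm i e1 e2 e3 : value mm i (Ite e1 e2 e3) =
  if value mm i e1 != 0 then value mm i e2 else value mm i e3. Proof. by []. Qed.
Let ev_var l i j : j < 16 -> value (layout nS m input l) i (Var j) = nth no_cells l j 0.
Proof. exact: value_Arr. Qed.
Let evs := (ev_N, ev_var, evE, ev_ite, ev_bin, ev_cst, ev_pid).

Definition arrays (fX fi fB fh fT fL fG fcnt frk fA fS fd fsrt fcov fchs : nat -> nat) :=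
  [:: fX; fi; fB; fh; fT; fL; fG; fcnt; frk; fA; fS; fd; fsrt; fcov; fchs].

(** The body of [draw_times] starts at time 2, the cost of its processor count [Read (Cst 1)]. *)
Definition drawn t := if t < nT then draw om 2 t %% N else 0.

Let N_gt0 : 0 < N. Proof. by rewrite /N; nia. Qed.

Lemma drawn_lt t : drawn t < N.
Proof. by rewrite /drawn; case: ifP => _; rewrite ?ltn_pmod. Qed.

Lemma draw_lt t i : draw om t i < 2 ^ w.
Proof.
rewrite /draw; case: (insub t) => [t'|]; last by rewrite expn_gt0.
by case: (insub i) => [i'|]; rewrite ?expn_gt0.
Qed.

Lemma exec_draw_times : exists s,
  [/\ exec om rho (draw_times q) (State (nth 0 input) 0 0) s,
      memory s =1 layout nS m input (arrays drawn no_cells no_cells no_cells no_cells no_cells no_cells no_cells no_cells no_cells no_cells no_cells no_cells no_cells no_cells),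
      bounded B (arrays drawn no_cells no_cells no_cells no_cells no_cells no_cells no_cells no_cells no_cells no_cells no_cells no_cells no_cells no_cells),
      depth s <= step_cost & work s <= step_cost * nT.+1].
Proof.
have b0 : bounded B [::] by move=> j x; rewrite nth_nil.
have m0 : nth 0 input =1 layout nS m input [::].
  move=> x; rewrite /layout; case: ltnP => // Qx; rewrite nth_nil nth_default // size_inp.
  by apply: leq_trans Qx; rewrite leq_addr.
have ev_i i r e : i <= B -> admissible q e -> eval w (nth 0 input) i r e = value (layout nS m input [::]) i e.
  by move=> iB ge; apply: (@eval_layout nS m input w q B).
have NB : N <= B by move: hB; lia.
have nTB : nT <= B by move: NB; rewrite /N; nia.
have Ek : eval0 om (State (nth 0 input) 0 0) (Read (Cst 1)) = nT.
  by rewrite /eval0 ev_i //= layout_low.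
have NX : N < 2 ^ w.
  apply: leq_ltn_trans Bw; apply: leq_trans NB _; rewrite -{1}(expn1 B) leq_pexp2l //.
  by apply: leq_trans B16.
eexists; split; first by apply: exec_pardo.
- rewrite Ek => x; set s1 := charge _ _ _.
  apply: (@par_write_elim _ _ _ om rho s1 nT _ _ _ x
    (fun y => y = layout nS m input (arrays drawn no_cells no_cells no_cells no_cells no_cells no_cells no_cells no_cells no_cells no_cells no_cells no_cells no_cells no_cells) x)) => [i lt _|hx].
    rewrite ev_i ?(leq_trans (ltnW lt)) //.
    rewrite (value_addr inp0 inp2) => <-; rewrite layout_array //.
    have -> : forall r, r < 2 ^ w -> eval w (memory s1) i r (Bin OMod Rnd (Nexpr q)) = r %% N.
      move=> r rw;
      transitivity (((r %% 2 ^ w) %% eval w (nth 0 input) i r (Nexpr q)) %% 2 ^ w); first by [].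
      have gN : admissible q (Nexpr q) by solve_admissible.
      by rewrite ev_i ?(leq_trans (ltnW lt)) // ev_N (modn_small rw) modn_small // (leq_ltn_trans _ rw) ?leq_mod.
    - by rewrite /= /drawn lt.
    exact: draw_lt.
  rewrite [memory s1 x]m0 /layout; case: ltnP => // Qx; rewrite nth_nil.
  case E : (_ %% 16) => [|j]; last by move: j {E}; do 14!(case=> //); move=> j; rewrite /= nth_nil.
  rewrite /= /drawn; case: ltnP => // lt.
  case: (hx _ lt); rewrite ?ev_i ?(leq_trans (ltnW lt)) //.
  rewrite (value_addr inp0 inp2) ev_pid; move: (Qbase nS m) Qx (divn_eq (x - Qbase nS m) 16) E => Qb; clear; lia.
- case=> [|j] x; last by move: j; do 14!(case=> //); move=> j; rewrite /= nth_nil.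
  by apply: leq_trans (ltnW (drawn_lt x)) NB.
- by [].
- rewrite Ek /pardo; set c := (cost _ + cost _ + cost _).+1.
  have c1 : c <= step_cost by [].
  have c2 : cost (Read (Cst 1)) <= step_cost by [].
  apply: leq_trans (_ : cost (Read (Cst 1)) + nT * c <= _); first by [].
  by rewrite mulnS leq_add // mulnC leq_mul2r c1 orbT.
Qed.

Variables (X : nat -> nat) (L : nat).
Hypothesis XN : forall t, X t < N.
Hypothesis L_min : forall j, j < L -> start q j < N.
Hypothesis L_ge : N <= start q L.

Let L_gt0 : 0 < L.
Proof. by move: L_ge; case: L => //; rewrite /=; move: qN q_gt0; lia. Qed.

(** The last bucket may overshoot [N], but its width is at most [q] plus its start, which is below
    [N]. *)
Let start_ub j : j <= L -> start q j <= 3 * N.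
Proof.
case: j => // j /L_min lt /=; have := width_start q j; move: qN; lia.
Qed.

Ltac step_pardo newv n :=
  eapply (@run_pardo _ _ _ _ _ _ _ newv n);
  [by []|solve_admissible|solve_admissible|solve_admissible|solve_admissible| | | | | |reflexivity].
Ltac step_assign c :=
  eapply (@run_assign _ _ _ _ c); [by []|solve_admissible| | |by case|reflexivity].

Definition table u x := if x < start q u then bucket_of q x else 0.

Definition st_table u :=
  arrays X (scalar u) (scalar (start q u)) (scalar (width q u)) (table u) no_cells no_cells no_cells no_cells no_cells no_cells no_cells no_cells no_cells no_cells.

Let L_ub : L <= 3 * N.
Proof. exact: leq_trans (start_ge q_gt0 L) (start_ub (leqnn L)). Qed.

Let table_ub u x : u <= L -> table u x <= B.
Proof.
move=> uL; rewrite /table -bucket_of_lt //; case: ltnP => // lt.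
by move: L_ub hB; lia.
Qed.

(** An iteration costs the width of its bucket, so the total is governed by [start q L], which is
    linear in [N]. *)
Lemma run_fill_table :
  run (fill_table q) (arrays X no_cells no_cells no_cells no_cells no_cells no_cells no_cells no_cells no_cells no_cells no_cells no_cells no_cells no_cells) (st_table L)
   (step_cost + (L * (max_cost + 4 * step_cost) + max_cost))
   (step_cost * 2 + (\sum_(u < L) (max_cost + step_cost * (width q u + 7)) + max_cost)).
Proof.
apply: runs_seq.
  by step_assign q.
apply: (@runs_ext _ _ _ _ _ _ _ _ _ _ _ (st_table 0) _ (st_table L)) => //; last first.
  do 15!(case=> //); by case.
eapply (@run_while _ _ _ _ (4 * step_cost) (fun u => step_cost * (width q u + 7))) => [|u uL||u uL].
- by solve_admissible.
- by rewrite !evs //= L_min.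
- by rewrite !evs //= ltnNge L_ge.
have uB := start_ub uL; rewrite /= in uB.
have LB := L_ub.
apply: runs_leq.
  apply: runs_seq.
    step_pardo (table u.+1) (width q u).
    - by rewrite !evs.
    - by move: hB; lia.
    - by move=> x; apply: table_ub.
    - move=> i iu _; rewrite !evs //= /table /= ltn_add2l iu; symmetry; apply: bucket_ofE => //.
      by rewrite leq_addr /= ltn_add2l.
    - move=> x H; rewrite /= /table /=; case: (ltnP x (start q u)) => lt.
        by rewrite (leq_trans lt) // leq_addr.
      case: ltnP => // lt2; case: (H (x - start q u)) => //; first by lia.
      by rewrite !evs //= subnKC.
  apply: runs_seq.
    by step_assign (start q u.+1); [rewrite !evs|move: hB => /=; lia].
  apply: runs_seq.
    step_assign (width q u.+1); [by rewrite !evs|].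
    have := leq_div (width q u) q; move: hB => /=; lia.
  by step_assign u.+1; [rewrite !evs //= addn1|move: hB; lia].
- by lia.
- by lia.
Qed.
Variables (src tgt : nat -> nat).
Hypothesis src_inp : forall e, e < m -> nth 0 input (3 + 2 * e) = src e.
Hypothesis tgt_inp : forall e, e < m -> nth 0 input (4 + 2 * e) = tgt e.

Let ev_m l i : value (layout nS m input l) i (Read (Cst 2)) = m.
Proof. by rewrite /= layout_low. Qed.

Let ev_src l i e e' : value (layout nS m input l) i e = e' -> e' < m ->
  value (layout nS m input l) i (Src e) = src e'.
Proof. by move=> <- lt; rewrite -src_inp // /= layout_low // /Qbase; lia. Qed.

Let ev_tgt l i e e' : value (layout nS m input l) i e = e' -> e' < m ->
  value (layout nS m input l) i (Tgt e) = tgt e'.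
Proof. by move=> <- lt; rewrite -tgt_inp // /= layout_low // /Qbase; lia. Qed.

Let G := m %/ L + 1.
Let time t := bucket_of q (X t).
Let cell e := time (tgt e) * G + e %% G.

(** This makes [L] steps enough to exhaust every residue class modulo [G]. *)
Let LG : m < L * G.
Proof. by rewrite /G mulnDr muln1 mulnC; move: (divn_eq m L) (ltn_pmod m L_gt0); lia. Qed.

Let G_gt0 : 0 < G. Proof. by rewrite /G addn1. Qed.

Let G_ub : G <= m + 1. Proof. by rewrite leq_add2r leq_div. Qed.

Let time_lt t : time t < L.
Proof. by rewrite bucket_of_lt // (leq_trans (XN t)). Qed.

Let table_time t : table L (X t) = time t.
Proof. by rewrite /table (leq_trans (XN t)). Qed.

Let cell_mod e : cell e %% G = e %% G.
Proof. by rewrite /cell modnMDl modn_mod. Qed.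

Let cell_lt e : cell e < L * G.
Proof.
apply: leq_trans (_ : (time (tgt e)).+1 * G <= _); last by rewrite leq_mul2r time_lt orbT.
by rewrite /cell mulSn [G + _]addnC ltn_add2l ltn_mod.
Qed.

Definition arrays_at i cnt rk A S d srt cov chs :=
  arrays X (scalar i) (scalar (start q L)) (scalar (width q L)) (table L) (scalar L) (scalar G)
     cnt rk A S d srt cov chs.

Lemma run_set_sizes : run set_sizes (st_table L) (arrays_at 0 no_cells no_cells no_cells no_cells no_cells no_cells no_cells no_cells)
  (3 * step_cost) (6 * step_cost).
Proof.
have LB := L_ub.
apply: runs_leq.
  apply: runs_seq.
    by step_assign L; [rewrite !evs|move: hB; lia].
  apply: runs_seq.
    by step_assign G; [rewrite !evs // ev_m|move: G_ub hB; lia].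
  by step_assign 0.
- by lia.
- by lia.
Qed.

(** Edge [e] is treated in step [e %/ G] by processor [e %% G]; the test [e %/ G < u] selects the
    edges of the first [u] steps. *)
Definition cell_count u z := count (fun e => (cell e == z) && (e %/ G < u)) (iota 0 m).
Definition rank_in_cell u e := if (e < m) && (e %/ G < u) then cell_count (e %/ G) (cell e) else 0.

Let cntf_ub u z : cell_count u z <= m.
Proof. by rewrite -[leqRHS](size_iota 0 m) count_size. Qed.

(** Counter [z] belongs to class [z %% G], which treats the single edge [u * G + z %% G] in step
    [u]. *)
Let cntfS u z : cell_count u.+1 z =
  cell_count u z + ((u * G + z %% G < m) && (cell (u * G + z %% G) == z)).
Proof.
set e0 := u * G + z %% G.
have e0u : e0 %/ G = u by rewrite divnMDl // divn_small ?addn0 // ltn_mod.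
have e0z : e0 %% G = z %% G by rewrite modnMDl modn_mod.
transitivity (cell_count u z + count (fun e => (e == e0) && (cell e0 == z)) (iota 0 m)).
  rewrite /cell_count; elim: (iota 0 m) => //= e s ->.
  have -> : (cell e == z) && (e %/ G < u.+1) =
    ((cell e == z) && (e %/ G < u)) || ((e == e0) && (cell e0 == z)).
    rewrite ltnS leq_eqVlt andb_orr orbC; congr (_ || _).
    apply/andP/andP => [[/eqP cz /eqP eu]|[/eqP -> /eqP ->]]; last by rewrite e0u !eqxx.
    have <- : e = e0 by rewrite (divn_eq e G) eu -cell_mod cz.
    by rewrite cz !eqxx.
  case: (altP (e =P e0)) => [->|] /=; rewrite ?e0u ?ltnn ?andbF ?orbF /=; lia.
congr (_ + _); case: (cell e0 == z); last first.
  by rewrite andbF (eq_count (a2 := pred0)) ?count_pred0 // => e; rewrite andbF.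
rewrite andbT (eq_count (a2 := pred1 e0)) => [|e]; last by rewrite andbT.
by rewrite count_uniq_mem ?iota_uniq // mem_iota.
Qed.

Definition st_count u := arrays_at u (cell_count u) (rank_in_cell u) no_cells no_cells no_cells no_cells no_cells no_cells.

(** Processor [j] touches only counters of class [j], so no counter is shared; each rank is read
    before its counter is raised. *)
Lemma run_count_cells : run count_cells (arrays_at 0 no_cells no_cells no_cells no_cells no_cells no_cells no_cells no_cells) (st_count L)
  (L * (max_cost + 3 * step_cost) + max_cost)
  (\sum_(u < L) (max_cost + step_cost * (2 * G + 4)) + max_cost).
Proof.
have LB := L_ub.
apply: (@runs_ext _ _ _ _ _ _ _ _ _ _ _ (st_count 0) _ (st_count L)) => //; last first.
  do 7!(case=> //); case.
    by move=> x; rewrite /= /cell_count (eq_count (a2 := pred0)) ?count_pred0 // => e; rewrite andbF.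
  by case; [move=> x; rewrite /= /rank_in_cell ltn0 andbF|do 8!(case=> //)].
eapply (@run_while _ _ _ _ (3 * step_cost) (fun u => step_cost * (2 * G + 4))) => [|u uL||u uL].
- by solve_admissible.
- by rewrite !evs //= uL.
- by rewrite !evs //= ltnn.
apply: runs_leq.
  apply: runs_seq.
    step_pardo (rank_in_cell u.+1) G.
    - by rewrite !evs.
    - by move: G_ub hB; lia.
    - by move=> x; rewrite /rank_in_cell; case: ifP => // _; apply: leq_trans (cntf_ub _ _) _; move: hB; lia.
    - move=> j jG; rewrite !evs // ev_m => lt.
      have {}lt : u * G + j < m by move: lt => /=; case: ltnP.
      have eu : (u * G + j) %/ G = u by rewrite divnMDl // divn_small ?addn0.
      rewrite (@ev_tgt _ _ _ (u * G + j)) ?evs //= table_time /rank_in_cell eu lt ltnSn /=.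
      by congr cell_count; rewrite /cell modnMDl modn_small.
    - move=> e H; rewrite /= /rank_in_cell; case: (ltnP e m) => //= em.
      rewrite ltnS leq_eqVlt; case: eqP => //= eu; case: (H (e %% G)); rewrite ?ltn_mod //.
        by rewrite !evs // ev_m /= -eu -divn_eq em.
      by rewrite !evs //= -eu -divn_eq.
  apply: runs_seq.
    step_pardo (cell_count u.+1) G.
    - by rewrite !evs.
    - by move: G_ub hB; lia.
    - by move=> x; apply: leq_trans (cntf_ub _ _) _; move: hB; lia.
    - move=> j jG; rewrite !evs // ev_m => lt.
      have {}lt : u * G + j < m by move: lt => /=; case: ltnP.
      rewrite (@ev_tgt _ _ _ (u * G + j)) ?evs //= table_time.
      have -> : time (tgt (u * G + j)) * G + j = cell (u * G + j) by rewrite /cell modnMDl modn_small.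
      by rewrite cntfS cell_mod modnMDl modn_small // lt eqxx.
    - move=> z H; rewrite cntfS; case: (ltnP _ m) => //= em; last by rewrite addn0.
      case: eqP => [ez|]; last by rewrite addn0.
      case: (H (z %% G)); rewrite ?ltn_mod //.
        by rewrite !evs // ev_m /= em.
      rewrite !evs // (@ev_tgt _ _ _ (u * G + z %% G)) ?evs //= table_time.
      by rewrite -[RHS]ez /cell modnMDl modn_mod.
  by step_assign u.+1; [rewrite !evs //= addn1|move: hB; lia].
- by lia.
- by lia.
Qed.

Definition edges_before z := count (fun e => cell e < z) (iota 0 m).

Let cntf_L z : cell_count L z = count (fun e => cell e == z) (iota 0 m).
Proof.
apply: eq_in_count => e; rewrite mem_iota add0n => /andP[_ em].
by rewrite ltn_divLR // (ltn_trans em) // andbT.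
Qed.

Let beforeS z : edges_before z.+1 = edges_before z + cell_count L z.
Proof.
rewrite cntf_L /edges_before; elim: (iota 0 m) => //= e s ->.
by rewrite ltnS leq_eqVlt; case: ltngtP => //= _; lia.
Qed.

Let before0 : edges_before 0 = 0.
Proof. by rewrite /edges_before (eq_count (a2 := pred0)) ?count_pred0. Qed.

Let before_ub z : edges_before z <= m.
Proof. by rewrite -[leqRHS](size_iota 0 m) count_size. Qed.

Let leq_before : {homo edges_before : x y / x <= y}.
Proof. by move=> x y xy; apply: sub_count => e /= /leq_trans; apply. Qed.

Let before_all : edges_before (L * G) = m.
Proof.
rewrite -[RHS](size_iota 0 m); apply/eqP; rewrite -all_count; apply/allP => e _; exact: cell_lt.
Qed.

(** Slot [z] sits at offset [z %% L] of block [z %/ L] and is filled in the step given by its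
    offset. *)
Definition in_block u z := if (z %% L < u) && (z %/ L < G) then edges_before z - edges_before (z %/ L * L) else 0.
Definition block_sum u x :=
  if x is b.+1 then if b < G then edges_before (b * L + u) - edges_before (b * L) else 0 else 0.
Definition st_blocks u := arrays_at u (cell_count L) (rank_in_cell L) (in_block u) (block_sum u) no_cells no_cells no_cells no_cells.

Let in_block_ub u z : in_block u z <= B.
Proof. by rewrite /in_block; case: ifP => // _; have := before_ub z; move: hB; lia. Qed.

Let block_sum_ub u x : block_sum u x <= B.
Proof.
case: x => //= b; case: ifP => // _; have := before_ub (b * L + u); move: hB; lia.
Qed.

Lemma run_scan_blocks : run scan_blocks (st_count L) (st_blocks L)
  (step_cost + (L * (max_cost + 3 * step_cost) + max_cost))
  (2 * step_cost + (\sum_(u < L) (max_cost + step_cost * (2 * G + 4)) + max_cost)).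
Proof.
have LB := L_ub; rewrite [2 * _]mulnC.
apply: runs_seq.
  by step_assign 0.
apply: (@runs_ext _ _ _ _ _ _ _ _ _ _ _ (st_blocks 0) _ (st_blocks L)) => //; last first.
  do 9!(case=> //); case; last case.
  - by move=> z; rewrite /= /in_block.
  - by case=> // b; rewrite [RHS](_ : _ = block_sum 0 b.+1) // /block_sum addn0 subnn if_same.
  - by do 6!(case=> //).
eapply (@run_while _ _ _ _ (3 * step_cost) (fun u => step_cost * (2 * G + 4))) => [|u uL||u uL].
- by solve_admissible.
- by rewrite !evs //= uL.
- by rewrite !evs //= ltnn.
apply: runs_leq.
  apply: runs_seq.
    step_pardo (in_block u.+1) G => //.
    - by rewrite !evs.
    - by move: G_ub hB; lia.
    - move=> b bG _; rewrite !evs //= /in_block modnMDl divnMDl // modn_small // ltnSn.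
      by rewrite divn_small // addn0 addn1 /= bG.
    - move=> z H; rewrite /= /in_block; case: (ltnP (z %/ L) G) => zG; rewrite ?andbF // !andbT.
      rewrite ltnS leq_eqVlt; case: eqP => //= zu; case: (H (z %/ L)) => //.
      by rewrite !evs //= -zu -divn_eq.
  apply: runs_seq.
    step_pardo (block_sum u.+1) G => //.
    - by rewrite !evs.
    - by move: G_ub hB; lia.
    - move=> b bG _; rewrite !evs //= addn1 /= bG addnS beforeS.
      by have := @leq_before (b * L) (b * L + u); rewrite leq_addr => /(_ isT); lia.
    - case=> [//|b] H; rewrite [RHS](_ : _ = block_sum u b.+1) // /block_sum.
      case: ltnP => // bG; case: (H b) => //.
      by rewrite !evs //= addn1.
  by step_assign u.+1; [rewrite !evs //= addn1|move: hB; lia].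
- by lia.
- by lia.
Qed.

(* The sum of the min(d, x) blocks preceding position x. *)
Definition window d x := if x <= G then edges_before (x * L) - edges_before ((x - d) * L) else 0.
Definition st_sums r :=
  arrays_at L (cell_count L) (rank_in_cell L) (in_block L) (window (2 ^ r)) (scalar (2 ^ r)) no_cells no_cells no_cells.

(** Adding the sum of the [d] blocks before [x - d] to that of the [d] blocks before [x] doubles the
    window; truncated subtraction sends indices beyond the start to cell 0, which holds 0. *)
Lemma run_scan_sums : run scan_sums (st_blocks L) (st_sums (up_log 2 G))
  (step_cost + (up_log 2 G * (max_cost + 2 * step_cost) + max_cost))
  (2 * step_cost + (\sum_(r < up_log 2 G) (max_cost + step_cost * (G + 3)) + max_cost)).
Proof.
have LB := L_ub; rewrite [2 * _ in X in run _ _ _ _ X]mulnC.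
apply: runs_seq.
  by step_assign 1; [|move: B16; lia].
apply: (@runs_ext _ _ _ _ _ _ _ _ _ _ _ (st_sums 0) _ (st_sums (up_log 2 G))) => //; last first.
  do 10!(case=> //); case.
  - move=> x; rewrite [LHS](_ : _ = block_sum L x) // [RHS](_ : _ = window 1 x) //.
    by case: x => [|b]; rewrite /window /block_sum ?subnn ?if_same //= subSS subn0 mulSnr.
  - by do 5!(case=> //).
eapply (@run_while _ _ _ _ (2 * step_cost) (fun u => step_cost * (G + 3))) => [|r rlt||r rlt].
- by solve_admissible.
- by rewrite !evs //=; case: ltnP => // /(up_log_min (isT : 1 < 2)); rewrite leqNgt rlt.
- rewrite !evs //= ltnNge; have := up_logP G (isT : 1 < 2); by move=> ->.
have rG : 2 ^ r < G.
  rewrite ltnNge; apply/negP => /(up_log_min (isT : 1 < 2)); lia.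
apply: runs_leq.
  apply: runs_seq.
    step_pardo (window (2 ^ r.+1)) G.
    - by rewrite !evs.
    - by move: G_ub hB; lia.
    - move=> x; rewrite /window; case: ifP => // _; have := before_ub (x * L); move: hB; lia.
    - move=> b bG _; rewrite !evs //= addn1 /window bG.
      rewrite (leq_trans (leq_subr _ _)) // expnS mul2n -addnn subnDA.
      have h1 := @leq_before ((b.+1 - 2 ^ r) * L) (b.+1 * L).
      have h2 := @leq_before ((b.+1 - 2 ^ r - 2 ^ r) * L) ((b.+1 - 2 ^ r) * L).
      have {}h1 := h1 (leq_mul (leq_subr _ _) (leqnn _)).
      have {}h2 := h2 (leq_mul (leq_subr _ _) (leqnn _)).
      lia.
    - move=> x H; rewrite [RHS](_ : _ = window (2 ^ r) x) // /window.
      case: x H => [|b] H; rewrite ?subnn //; case: ltnP => // bG; case: (H b) => //.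
      by rewrite !evs //= addn1.
  by step_assign (2 ^ r.+1); [rewrite !evs //= expnS mul2n addnn|move: G_ub hB; rewrite expnS; lia].
- by lia.
- by lia.
Qed.

Let R := up_log 2 G.

(** Since [2 ^ R >= G], the windows reach the first block and hold full prefix sums of blocks. *)
Let ev_prefix l p e z : nth no_cells l 5 = scalar L -> nth no_cells l 9 = in_block L ->
  nth no_cells l 10 = window (2 ^ R) -> z <= L * G ->
  value (layout nS m input l) p e = z -> value (layout nS m input l) p (Prefix e) = edges_before z.
Proof.
move=> l5 l9 l10 zLG ez; rewrite !evs // ez l5 l9 l10 /= /in_block /window ltn_mod L_gt0 /=.
have zG : z %/ L <= G by rewrite -[leqRHS](mulKn G L_gt0) leq_div2r.
rewrite zG; have -> : z %/ L - 2 ^ R = 0.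
  by apply/eqP; rewrite subn_eq0 (leq_trans zG) // up_logP.
rewrite mul0n before0 subn0; case: ltnP => zG'.
  by rewrite subnK // leq_before // leq_trunc_div.
(* This is the case [z = L * G], one past the last slot: array 9 gives 0 and the block sums give
   everything. *)
rewrite add0n; congr edges_before; apply/eqP; rewrite eqn_leq leq_trunc_div /=.
by apply: leq_trans zLG _; rewrite mulnC leq_mul2r zG' orbT.
Qed.

Let group_lt e : e < m -> e %/ G < L.
Proof. by move=> em; rewrite ltn_divLR // (ltn_trans em). Qed.

Let cntf_own e : e < m -> cell_count (e %/ G).+1 (cell e) = (cell_count (e %/ G) (cell e)).+1.
Proof. by move=> em; rewrite cntfS cell_mod -divn_eq em eqxx addn1. Qed.

Let leq_cntf u v z : u <= v -> cell_count u z <= cell_count v z.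
Proof.
by move=> uv; apply: sub_count => e /andP[/= ->] /= /leq_trans; apply.
Qed.

Let rankf_lt e : e < m -> rank_in_cell L e < cell_count L (cell e).
Proof.
move=> em; rewrite /rank_in_cell em group_lt //= -cntf_own //; apply: leq_cntf; exact: group_lt.
Qed.

Let rankf_inj e e' : e < m -> e' < m -> cell e = cell e' -> rank_in_cell L e = rank_in_cell L e' -> e = e'.
Proof.
move=> em em' ee'; rewrite /rank_in_cell em em' !group_lt //= => rr.
rewrite (divn_eq e G) (divn_eq e' G) -(cell_mod e) -(cell_mod e') ee'.
case: (ltngtP (e %/ G) (e' %/ G)) => [lt|lt|-> //].
  by have := leq_cntf (cell e) lt; rewrite cntf_own // rr ee' ltnn.
by have := leq_cntf (cell e') lt; rewrite cntf_own // -rr ee' ltnn.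
Qed.

Definition sorted_pos e := edges_before (cell e) + rank_in_cell L e.

Let sorted_pos_range e : e < m -> edges_before (cell e) <= sorted_pos e < edges_before (cell e).+1.
Proof. by move=> em; rewrite leq_addr beforeS ltn_add2l rankf_lt. Qed.

(** Distinct counters own disjoint ranges, and ranks separate the edges of one counter. So the
    writes of [sort_edges] never collide. *)
Let sorted_pos_inj e e' : e < m -> e' < m -> sorted_pos e = sorted_pos e' -> e = e'.
Proof.
move=> em em' pp; have /andP[h1 h2] := sorted_pos_range em; have /andP[h3 h4] := sorted_pos_range em'.
case: (ltngtP (cell e) (cell e')) => [/leq_before lt|/leq_before lt|ee'].
- by move: (leq_trans h2 lt); rewrite ltnNge pp h3.
- by move: (leq_trans h4 lt); rewrite ltnNge -pp h1.
by apply: rankf_inj => //; move: pp; rewrite /sorted_pos ee' => /addnI.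
Qed.

(** The inverse of [sorted_pos]; [find] returns [m] when no edge has position [x]. *)
Definition sorted_edge x :=
  let e := find (fun e => sorted_pos e == x) (iota 0 m) in if e < m then e.+1 else 0.

Let sorted_edge_pos e : e < m -> sorted_edge (sorted_pos e) = e.+1.
Proof.
move=> em; rewrite /sorted_edge; set i := find _ _.
have h : has (fun e' => sorted_pos e' == sorted_pos e) (iota 0 m).
  by apply/hasP; exists e; rewrite ?mem_iota.
have im : i < m by move: h; rewrite has_find size_iota.
rewrite im; congr _.+1; apply: sorted_pos_inj => //.
by have /eqP := nth_find 0 h; rewrite nth_iota.
Qed.

Let sorted_edgeP x e : sorted_edge x = e.+1 -> e < m /\ sorted_pos e = x.
Proof.
rewrite /sorted_edge; set i := find _ _; case: ifP => // im [<-]; split => //.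
have h : has (fun e' => sorted_pos e' == x) (iota 0 m) by rewrite has_find size_iota.
by have /eqP := nth_find 0 h; rewrite nth_iota.
Qed.

Let sorted_edge_ub x : sorted_edge x <= m.
Proof. by rewrite /sorted_edge; case: ifP. Qed.

Definition st_sorted i d cov chs :=
  arrays_at i (cell_count L) (rank_in_cell L) (in_block L) (window (2 ^ R)) (scalar d) sorted_edge cov chs.

Lemma run_sort_edges : run sort_edges (st_sums R) (st_sorted L (2 ^ R) no_cells no_cells)
  step_cost (step_cost * m.+1).
Proof.
step_pardo sorted_edge m => //.
- by move: hB; lia.
- by move=> x; apply: leq_trans (sorted_edge_ub x) _; move: hB; lia.
- move=> e em _.
  have E : value (layout nS m input (st_sums R)) e
    (Bin OAdd (Prefix (Cell Pid (Bin OMod Pid (Var 6)))) (Arr 8 Pid)) = sorted_pos e.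
    rewrite ev_bin (@ev_prefix _ _ _ (cell e)) ?(ltnW (cell_lt e)) //.
      by rewrite !evs.
    by rewrite !evs // (@ev_tgt _ _ _ e) //= table_time.
  by rewrite E sorted_edge_pos // !evs //= addn1.
- move=> x H; rewrite /sorted_edge; case: ifP => // im.
  set e := find _ _ in im.
  have h : has (fun e' => sorted_pos e' == x) (iota 0 m) by rewrite has_find size_iota.
  have px : sorted_pos e = x by have /eqP := nth_find 0 h; rewrite nth_iota.
  case: (H e im) => //.
  rewrite ev_bin (@ev_prefix _ _ _ (cell e)) ?(ltnW (cell_lt e)) //.
    by rewrite !evs.
  by rewrite !evs // (@ev_tgt _ _ _ e) //= table_time.
Qed.

(** The recursion of [chosen] transcribed to edge indices; [chosen_flagE] identifies the two. *)
Fixpoint chosen_flag u s : bool :=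
  if u is u'.+1 then chosen_flag u' s ||
    has (fun e => [&& src e == s, time (tgt e) == u' &
      ~~ has (fun e' => (tgt e' == tgt e) && chosen_flag u' (src e')) (iota 0 m)]) (iota 0 m)
  else false.

(* An element is tested only in the round of its own bucket. *)
Definition covered_flag u t : bool :=
  (time t < u) && has (fun e => (tgt e == t) && chosen_flag (time t) (src e)) (iota 0 m).

Definition st_round u d :=
  st_sorted u d (fun t => covered_flag u t) (fun s => chosen_flag u s).

Let slots u := edges_before (u.+1 * G) - edges_before (u * G).

Let cell_range e : time (tgt e) * G <= cell e < (time (tgt e)).+1 * G.
Proof. by rewrite /cell leq_addr mulSn [G + _]addnC ltn_add2l ltn_mod. Qed.

Let slot_of e : e < m -> exists p, p < slots (time (tgt e)) /\ edges_before (time (tgt e) * G) + p = sorted_pos e.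
Proof.
move=> em; have /andP[h1 h2] := cell_range e; have /andP[h3 h4] := sorted_pos_range em.
move: h1 h2 => /leq_before h1 /leq_before h2.
exists (sorted_pos e - edges_before (time (tgt e) * G)); rewrite /slots; split; lia.
Qed.

Let ev_entry l p d : nth no_cells l 11 = scalar d -> nth no_cells l 12 = sorted_edge ->
  value (layout nS m input l) p Entry = sorted_edge (d + p).
Proof. by move=> l11 l12; rewrite !evs // l11 l12. Qed.

Let ev_cur_edge l p d e : nth no_cells l 11 = scalar d -> nth no_cells l 12 = sorted_edge ->
  sorted_edge (d + p) = e.+1 -> value (layout nS m input l) p CurEdge = e.
Proof. by move=> l11 l12 de; rewrite ev_bin (ev_entry _ l11 l12) de ev_cst /= subn1. Qed.

Let ev_current l p u d g : nth no_cells l 0 = X -> nth no_cells l 1 = scalar u -> nth no_cells l 4 = table L ->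
  nth no_cells l 11 = scalar d -> nth no_cells l 12 = sorted_edge ->
  value (layout nS m input l) p (Current g) =
  if sorted_edge (d + p) is e.+1 then
    if time (tgt e) == u then value (layout nS m input l) p g else 0
  else 0.
Proof.
move=> l0 l1 l4 l11 l12; rewrite ev_ite (ev_entry _ l11 l12).
case E : (sorted_edge _) => [|e] //.
have [em _] := sorted_edgeP E.
have cur := ev_cur_edge l11 l12 E.
have bkt : value (layout nS m input l) p (Bucket CurEdge) = time (tgt e).
  by rewrite /Bucket !evE // (ev_tgt cur em) l0 l4 table_time.
by rewrite ev_ite ev_bin bkt ev_var // l1 ev_cst /=; case: (time _ == u).
Qed.

Let ev_range l p u : nth no_cells l 1 = scalar u -> nth no_cells l 5 = scalar L -> nth no_cells l 6 = scalar G ->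
  nth no_cells l 9 = in_block L -> nth no_cells l 10 = window (2 ^ R) ->
  nth no_cells l 11 = scalar (edges_before (u * G)) -> u < L ->
  value (layout nS m input l) p Range = slots u.
Proof.
move=> l1 l5 l6 l9 l10 l11 uL; rewrite ev_bin (@ev_prefix _ _ _ (u.+1 * G)) ?leq_mul2r ?uL ?orbT //.
  by rewrite ev_var // l11.
by rewrite !evs // l1 l6 /= addn1.
Qed.

(** All concurrent writes store 1, and the work of round [u] is proportional to the number [slots u]
    of edges in its bucket. *)
Lemma run_rounds : run rounds (st_sorted L (2 ^ R) no_cells no_cells) (st_round L (edges_before ((L - 1) * G)))
  (step_cost + (L * (max_cost + 4 * step_cost) + max_cost))
  (2 * step_cost + (\sum_(u < L) (max_cost + step_cost * (2 * slots u + 6)) + max_cost)).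
Proof.
have LB := L_ub; rewrite [2 * _ in X in run _ _ _ _ X]mulnC.
have slotsB u : u < L -> slots u <= B.
  by move=> uL; rewrite /slots; have := before_ub (u.+1 * G); move: hB; lia.
apply: runs_seq.
  by step_assign 0.
(* Array 11 holds the last window length before round 0, and the first slot of the previous bucket
   before any later round. *)
pose d u := if u is u'.+1 then edges_before (u' * G) else 2 ^ R.
apply: (@runs_ext _ _ _ _ _ _ _ _ _ _ _ (st_round 0 (d 0)) _ (st_round L (d L))) => //; last first.
  by move=> j x; move: L_gt0; rewrite /d -(prednK L_gt0) subn1.
eapply (@run_while _ _ (fun u => st_round u (d u)) _ (4 * step_cost)
   (fun u => step_cost * (2 * slots u + 6))) => [|u uL||u uL].
- by solve_admissible.
- by rewrite !evs //= uL.
- by rewrite !evs //= ltnn.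
apply: runs_leq.
  apply: runs_seq.
    step_assign (edges_before (u * G)); last by have := before_ub (u * G); move: hB; lia.
    rewrite (@ev_prefix _ _ _ (u * G)) ?leq_mul2r ?(ltnW uL) ?orbT //.
    by rewrite !evs.
  apply: runs_seq.
    step_pardo (fun t => covered_flag u.+1 t : nat) (slots u).
    - exact: ev_range.
    - exact: slotsB.
    - by move=> t; move: B16; case: covered_flag; lia.
    - move=> p pu; rewrite (@ev_current _ _ u (edges_before (u * G))) //.
      case E : sorted_edge => [|e] //; have [em _] := sorted_edgeP E.
      have cur := @ev_cur_edge _ p (edges_before (u * G)) e _ _ E.
      case: (altP (time (tgt e) =P u)) => // eu; rewrite !evE // (ev_src (cur _ _ _) em) // (ev_tgt (cur _ _ _) em) //.
      rewrite ev_cst => /= che; rewrite /covered_flag eu ltnSn /=.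
      have -> // : has (fun e' => (tgt e' == tgt e) && chosen_flag u (src e')) (iota 0 m).
      apply/hasP; exists e; rewrite ?mem_iota // eqxx; by case: chosen_flag che.
    (* If the flag of [t] had to rise, [t] would be in bucket [u] with an edge from a chosen set,
       and the processor at the slot of that edge would write it. *)
    - move=> t H; rewrite [RHS](_ : _ = nat_of_bool (covered_flag u t)) // /covered_flag ltnS leq_eqVlt.
      case: eqP => // tu; rewrite tu ltnn /=; case: hasP => // -[e].
      rewrite mem_iota => /= em /andP[/eqP te che].
      have [p []] := slot_of em; rewrite te tu => pu pe.
      have E : sorted_edge (edges_before (u * G) + p) = e.+1 by rewrite pe sorted_edge_pos.
      have cur := @ev_cur_edge _ p (edges_before (u * G)) e _ _ E.
      case: (H p pu); last by rewrite (ev_tgt (cur _ _ _) em).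
      rewrite (@ev_current _ _ u (edges_before (u * G))) // E te tu eqxx !evE // (ev_src (cur _ _ _) em) //=.
      by rewrite che.
  apply: runs_seq.
    step_pardo (fun s => chosen_flag u.+1 s : nat) (slots u).
    - exact: ev_range.
    - exact: slotsB.
    - by move=> t; move: B16; case: chosen_flag; lia.
    - move=> p pu; rewrite (@ev_current _ _ u (edges_before (u * G))) //.
      case E : sorted_edge => [|e] //; have [em _] := sorted_edgeP E.
      have cur := @ev_cur_edge _ p (edges_before (u * G)) e _ _ E.
      case: (altP (time (tgt e) =P u)) => // eu; rewrite ev_bin evE // (ev_src (cur _ _ _) em) // (ev_tgt (cur _ _ _) em) //.
      rewrite !ev_cst [nth _ _ _ _](_ : _ = nat_of_bool (covered_flag u.+1 (tgt e))) //= /covered_flag eu ltnSn /= => nc.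
      have -> : has (fun e0 => [&& src e0 == src e, time (tgt e0) == u &
        ~~ has (fun e' => (tgt e' == tgt e0) && chosen_flag u (src e')) (iota 0 m)]) (iota 0 m).
        apply/hasP; exists e; rewrite ?mem_iota // eqxx eu eqxx /=; by case: has nc.
      by rewrite orbT.
    - move=> s H; rewrite [RHS](_ : _ = nat_of_bool (chosen_flag u s)) //=.
      case: chosen_flag => //=; case: hasP => // -[e].
      rewrite mem_iota => /= em /and3P[/eqP se /eqP eu nc].
      have [p []] := slot_of em; rewrite eu => pu pe.
      have E : sorted_edge (edges_before (u * G) + p) = e.+1 by rewrite pe sorted_edge_pos.
      have cur := @ev_cur_edge _ p (edges_before (u * G)) e _ _ E.
      case: (H p pu); last by rewrite (ev_src (cur _ _ _) em).
      rewrite (@ev_current _ _ u (edges_before (u * G))) // E eu eqxx ev_bin evE // (ev_tgt (cur _ _ _) em) //.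
      rewrite !ev_cst [nth _ _ _ _](_ : _ = nat_of_bool (covered_flag u.+1 (tgt e))) //= /covered_flag eu ltnSn /=.
      by rewrite (negbTE nc).
  by step_assign u.+1; [rewrite !evs //= addn1|move: hB; lia].
- by lia.
- by lia.
Qed.

Let sum_width n : \sum_(u < n) width q u = start q n.
Proof. by elim: n => [|n IH]; rewrite ?big_ord0 // big_ord_recr IH. Qed.

Let sum_slots : \sum_(u < L) slots u = m.
Proof.
have H n : \sum_(u < n) slots u = edges_before (n * G).
  elim: n => [|n IH]; first by rewrite big_ord0 mul0n before0.
  by rewrite big_ord_recr IH /slots /= addnC subnK // leq_before // leq_mul2r leqnSn orbT.
by rewrite H before_all.
Qed.

Hypothesis m_ub : m <= nS * nT.

(** By [start_expn] the starts grow at most like [q * 2 ^ j], so reaching [N] takes at least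
    logarithmically many rounds. *)
Let size_lt_expn : nS + nT + 1 <= 2 ^ L.
Proof.
have := @start_expn q L; have := L_ge; rewrite /N; set n1 := nS + nT + 1; set p := 2 ^ L => h1 h2.
have h3 : q * (q * n1) <= q * p by rewrite mulnA; apply: leq_trans h1 _; move: h2; lia.
by rewrite leq_pmul2l // in h3; apply: leq_trans h3; rewrite leq_pmull.
Qed.

Let R_ub : R <= 2 * L.
Proof.
apply: up_log_min => //; apply: leq_trans G_ub _; rewrite mul2n -addnn expnD.
apply: leq_trans (leq_mul size_lt_expn size_lt_expn); move: m_ub; nia.
Qed.

Lemma run_main : run (main q)
  (arrays X no_cells no_cells no_cells no_cells no_cells no_cells no_cells no_cells no_cells no_cells no_cells no_cells no_cells no_cells) (st_round L (edges_before ((L - 1) * G)))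
  (200 * step_cost * L) (200 * step_cost * (N + m + 1)).
Proof.
have mc : max_cost <= step_cost by rewrite /step_cost; lia.
have LG_ub : L * G <= m + L by rewrite /G mulnDr muln1 leq_add2r mulnC leq_trunc_div.
(* The choice of [G] pays off here: doubling over the [G] block sums stays linear because [R] is at
   most [2 * L]. *)
have RG_ub : R * G <= 2 * (m + L).
  apply: leq_trans (_ : 2 * L * G <= _); first by rewrite leq_mul2r R_ub orbT.
  by rewrite -mulnA leq_mul2l LG_ub.
apply: runs_leq.
  apply: runs_seq run_fill_table _; apply: runs_seq run_set_sizes _.
  apply: runs_seq run_count_cells _; apply: runs_seq run_scan_blocks _.
  apply: runs_seq run_scan_sums _; apply: runs_seq run_sort_edges _.
  exact: run_rounds.
- move: R_ub L_gt0 mc; rewrite -/R; move: step_cost max_cost R => k c r rL L0 ck.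
  have h1 : r * k <= 2 * L * k by rewrite leq_mul2r rL orbT.
  have h2 : 1 * k <= L * k by rewrite leq_mul2r L0 orbT.
  have h3 : L * c <= L * k by rewrite leq_mul2l ck orbT.
  have h4 : r * c <= r * k by rewrite leq_mul2l ck orbT.
  move: {LG_ub RG_ub} h1 h2 h3 h4 ck; clear; lia.
have sumE n (f : nat -> nat) c :
    \sum_(u < n) (max_cost + step_cost * (f u + c)) =
    n * (max_cost + step_cost * c) + step_cost * \sum_(u < n) f u.
  rewrite (eq_bigr (fun u : 'I_n => (max_cost + step_cost * c) + step_cost * f u)); last first.
    by move=> u _; rewrite mulnDr addnCA addnC addnA.
  by rewrite big_split /= sum_nat_const card_ord big_distrr.
have sum_slots2 : \sum_(u < L) (2 * slots u) = 2 * m by rewrite -big_distrr /= sum_slots.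
rewrite (sumE _ (width q)) (sumE _ (fun=> 2 * G)) (sumE _ (fun=> G)) (sumE _ (fun u => 2 * slots u)).
rewrite sum_slots2 sum_width !sum_nat_const !card_ord -/R.
have sN := start_ub (leqnn L).
move: L_ub R_ub mc; move: step_cost max_cost R LG_ub RG_ub => k c r hLG hRG hL hr ck.
have h1 := leq_mul (leqnn k) sN; have h2 := leq_mul (leqnn k) hL.
have h3 := leq_mul (leqnn k) hLG; have h4 := leq_mul (leqnn k) hRG.
have h5 := leq_mul (leqnn k) hr; have h6 := leq_mul (leqnn L) ck; have h7 := leq_mul (leqnn r) ck.
move: h1 h2 h3 h4 h5 h6 h7 ck; rewrite !mulnDr; clear; lia.
Qed.

Lemma exec_write_output s d : memory s =1 layout nS m input (st_round L d) -> bounded B (st_round L d) ->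
  exists s', [/\ exec om rho write_output s s',
    forall x, x < nS -> memory s' (3 + 2 * m + x) = chosen_flag L x,
    depth s' <= depth s + step_cost & work s' <= work s + step_cost * nS.+1].
Proof.
move=> ms bl; have nSB : nS <= B by rewrite -inp0.
have ev_i i r e : i <= B -> admissible q e -> eval w (memory s) i r e = value (layout nS m input (st_round L d)) i e.
  by move=> iB ge; apply: (@eval_layout nS m input w q B).
have Ek : eval0 om s (Read (Cst 0)) = nS by rewrite /eval0 ev_i //= layout_low.
eexists; split; first by apply: exec_pardo.
- rewrite Ek => x xS; set s1 := charge _ _ _.
  apply: (@par_write_elim _ _ _ om rho s1 nS _ _ _ _ (fun y => y = chosen_flag L x)) => [i lt _|hx].
    rewrite !ev_i ?(leq_trans (ltnW lt)) // !ev_bin ev_m !ev_cst ev_pid => /addnI ->.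
    by rewrite evE.
  case: (hx _ xS); rewrite ?ev_i ?(leq_trans (ltnW xS)) //.
  by rewrite !ev_bin ev_m !ev_cst ev_pid.
- by rewrite /pardo /charge /= -addnA leq_add2l.
- rewrite Ek /pardo; set c := (cost _ + cost _ + cost _).+1.
  have c1 : c <= step_cost by [].
  have c2 : cost (Read (Cst 0)) <= step_cost by [].
  apply: leq_trans (_ : work s + cost (Read (Cst 0)) + nS * c <= _); first by [].
  by rewrite -addnA leq_add2l mulnS leq_add // mulnC leq_mul2r c1 orbT.
Qed.

End Phases.

(** * Edge indices versus the bipartite graph *)

Section Input.
Variables (nS nT : nat) (E : {set 'I_nS * 'I_nT}) (es : seq ('I_nS * 'I_nT)).
Hypothesis esE : es =i E.

Definition src_of e := nth 0 [seq val p.1 | p <- es] e.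
Definition tgt_of e := nth 0 [seq val p.2 | p <- es] e.

Lemma size_input_words : size (input_words es) = 3 + 2 * size es.
Proof. by rewrite /input_words size_cat; congr (3 + _); elim: es => //= p s ->; rewrite mulnS. Qed.

Lemma nth_input_words e :
  nth 0 (input_words es) (3 + 2 * e) = src_of e /\ nth 0 (input_words es) (4 + 2 * e) = tgt_of e.
Proof.
pose body := flatten [seq [:: val p.1; val p.2] | p <- es].
suff: nth 0 body (2 * e) = src_of e /\ nth 0 body (2 * e).+1 = tgt_of e by [].
rewrite /body /src_of /tgt_of; elim: es e => [|p s IH] [|e] //.
by rewrite mulnS; exact: IH.
Qed.

Lemma input_words_ub x : nth 0 (input_words es) x <= nS + nT + size es.
Proof.
have: all (fun y => y <= nS + nT + size es) (input_words es).
  rewrite /input_words all_cat /=; apply/andP; split; first by apply/and4P; split; lia.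
  apply/allP => y /flatten_mapP[[s t] _]; rewrite !inE /= => /orP[] /eqP ->.
    by have := ltn_ord s; lia.
  by have := ltn_ord t; lia.
case: (ltnP x (size (input_words es))) => lt; last by rewrite nth_default.
by move/(all_nthP 0); apply.
Qed.

Lemma has_edge (P : nat -> nat -> bool) :
  has (fun e => P (src_of e) (tgt_of e)) (iota 0 (size es)) = [exists p in E, P (val p.1) (val p.2)].
Proof.
transitivity (has (fun p => P (val p.1) (val p.2)) es).
  rewrite /src_of /tgt_of; elim: es => //= p s <-; congr (_ || _).
  by rewrite (iotaDl 1 0) has_map.
apply/hasP/exists_inP => -[p]; first by rewrite esE; exists p.
by exists p; rewrite ?esE.
Qed.

Variables (q : nat) (X : nat -> nat).
Let b (t : 'I_nT) := bucket_of q (X t).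

Lemma covered_flagE u (C : {set 'I_nS}) (t : 'I_nT) :
  (forall s : 'I_nS, chosen_flag (size es) q X src_of tgt_of u s = (s \in C)) ->
  has (fun e => (tgt_of e == t) && chosen_flag (size es) q X src_of tgt_of u (src_of e))
    (iota 0 (size es)) = covered E C t.
Proof.
move=> H.
rewrite (has_edge (fun x y => (y == t) && chosen_flag (size es) q X src_of tgt_of u x)).
apply/exists_inP/exists_inP => [[[s t'] /= st]|[s sC st]].
  by rewrite H => /andP[/eqP/val_inj <- sC]; exists s.
by exists (s, t) => //=; rewrite eqxx H.
Qed.

Lemma chosen_flagE u (s : 'I_nS) :
  chosen_flag (size es) q X src_of tgt_of u s = (s \in chosen E b u).
Proof.
elim: u s => [|u IH] s /=; first by rewrite inE.
rewrite inE IH; congr (_ || _).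
rewrite (has_edge (fun x y => [&& x == s, bucket_of q (X y) == u &
  ~~ has (fun e' => (tgt_of e' == y) && chosen_flag (size es) q X src_of tgt_of u (src_of e'))
    (iota 0 (size es))])).
apply/exists_inP/bigcupP => [[[s' t] /= st]|[t]].
  rewrite (covered_flagE _ IH) => /and3P[/eqP/val_inj <- tu nc].
  by exists t; rewrite ?inE //; apply/andP.
rewrite inE => /andP[tu nc] st; exists (s, t) => //=.
by rewrite (covered_flagE _ IH) eqxx nc andbT.
Qed.

End Input.

(** * Number of rounds and word length *)

Section Choice.
Variable q : nat.
Hypothesis q_gt0 : 0 < q.

Lemma rounds_exist N : exists L,
  [/\ N <= start q L, forall j, j < L -> start q j < N &
      forall k, N <= 2 ^ k -> L <= (2 * q * k).+1].
Proof.
have ex : exists L, N <= start q L by exists N; apply: start_ge.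
exists (ex_minn ex); case: ex_minnP => L h min; split => //.
  by move=> j jL; rewrite ltnNge; apply/negP => /min; rewrite leqNgt jL.
by move=> k Nk; apply: min; apply: leq_trans Nk _; apply: start_expn_lt.
Qed.

(** The first factor bounds the exponent of [B] as a power of 2 per unit of [lg], [max_cost] is the
    power required by [eval_value], and the last 1 gives strictness. *)
Definition word_factor := (10 * q ^ 2 + 38) * max_cost + 1.
Definition time_factor := 202 * step_cost * (q * q + 2 * q * (2 * q + 1) + 1).

Variables (nS nT m : nat).
Hypothesis m_ub : m <= nS * nT.
Let n := nS + nT.
Let N := q * q * (nS + nT + 1).
Let B := 10 * (N + m + 1) + 16.
Let lg := (trunc_log 2 n).+1.

Lemma succ_le_expn : n + 1 <= 2 ^ lg.
Proof. by rewrite addn1; apply: trunc_log_ltn. Qed.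

Lemma memory_bound : B ^ max_cost < 2 ^ (word_factor * lg).
Proof.
have h := succ_le_expn; set p := 2 ^ lg in h.
have p0 : 0 < p by rewrite expn_gt0.
have hN : N <= q ^ 2 * p by rewrite /N -mulnn leq_mul2l h orbT.
have hm : m + 1 <= p * p by apply: leq_trans (leq_mul h h); move: m_ub; rewrite /n; nia.
have hB : B <= (10 * q ^ 2 + 36) * (p * p).
  have h1 : q ^ 2 * p <= q ^ 2 * (p * p) by rewrite leq_mul2l leq_pmulr ?orbT.
  have h2 : 1 <= p * p by rewrite muln_gt0 p0.
  by rewrite /B; move: (q ^ 2 * (p * p)) (p * p) (q ^ 2) hN hm h1 h2 => *; lia.
have {}hB : B <= 2 ^ ((10 * q ^ 2 + 38) * lg).
  apply: leq_trans hB _; apply: leq_trans (_ : 2 ^ (10 * q ^ 2 + 36) * (p * p) <= _).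
    by rewrite leq_mul2r ltnW ?orbT // ltn_expl.
  rewrite /p -!expnD leq_pexp2l //; move: (10 * q ^ 2) => x; rewrite /lg; lia.
rewrite /word_factor mulnDl mul1n expnD.
apply: leq_ltn_trans (_ : 2 ^ ((10 * q ^ 2 + 38) * max_cost * lg) < _).
  by rewrite mulnAC expnM; case: max_cost => // k; rewrite leq_exp2r.
by rewrite ltn_Pmulr ?expn_gt0 // -{1}(expn0 2) ltn_exp2l.
Qed.

(** Take [k = 2 * q + lg]: here [q * q <= 2 ^ (2 * q)] and [n + 1 <= 2 ^ lg]. *)
Lemma rounds_bound L : (forall k, N <= 2 ^ k -> L <= (2 * q * k).+1) ->
  L <= (2 * q * (2 * q + 1) + 1) * lg.
Proof.
move=> H; apply: leq_trans (H (2 * q + lg) _) _.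
  rewrite /N expnD mul2n -addnn expnD; apply: leq_mul; last exact: succ_le_expn.
  by apply: leq_mul; apply: ltnW; apply: ltn_expl.
have : 1 <= lg by []; move: lg => l l0.
have : 2 * q * (2 * q + l) <= 2 * q * ((2 * q + 1) * l).
  by rewrite leq_mul2l; apply/orP; right; rewrite mulnDl mul1n leq_add2r leq_pmulr.
by rewrite mulnDl mul1n -mulnA; lia.
Qed.
End Choice.

(** * The whole algorithm: its run, expected size and resources *)

Lemma exec_program nS nT (E : {set 'I_nS * 'I_nT}) es q L w D K (om : tape w D K) rho :
  let m := size es in
  let N := q * q * (nS + nT + 1) in
  0 < q -> es =i E -> m <= nS * nT ->
  (10 * (N + m + 1) + 16) ^ max_cost < 2 ^ w ->
  (forall j, j < L -> start q j < N) -> N <= start q L ->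
  exists s, [/\ exec om rho (program q) (init_state es) s,
    output es s = chosen E (fun t : 'I_nT => bucket_of q (drawn nS nT q om t)) L,
    work s <= 202 * step_cost * (N + m + 1)
    & depth s <= 202 * step_cost * L].
Proof.
move=> m N q_gt0 esE m_ub Bw L_min L_ge; set B := _ + 16 in Bw.
have hB : 10 * (N + m + 1) <= B by rewrite leq_addr.
have B16 : 16 <= B by rewrite leq_addl.
have nN : nS + nT + 1 <= N by rewrite /N leq_pmull // muln_gt0 q_gt0.
have inpB x : nth 0 (input_words es) x <= B.
  by apply: leq_trans (input_words_ub es x) _; move: nN hB; rewrite -/m; clear; lia.
have sz : size (input_words es) = 3 + 2 * m := size_input_words es.
have i0 : nth 0 (input_words es) 0 = nS by [].
have i1 : nth 0 (input_words es) 1 = nT by [].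
have i2 : nth 0 (input_words es) 2 = m by [].
have isrc e : e < m -> nth 0 (input_words es) (3 + 2 * e) = src_of es e.
  by have [] := nth_input_words es e.
have itgt e : e < m -> nth 0 (input_words es) (4 + 2 * e) = tgt_of es e.
  by have [] := nth_input_words es e.
have [s1 [x1 m1 b1 d1 w1]] := exec_draw_times sz i0 i1 i2 om rho B16 q_gt0 Bw inpB hB.
have XN := drawn_lt sz i0 i1 i2 om B16 q_gt0 Bw hB.
have [s2 [x2 m2 b2 d2 w2]] := run_main sz i0 i1 i2 om rho B16 q_gt0 Bw inpB hB
  XN L_min L_ge isrc itgt m_ub m1 b1.
have [s3 [x3 m3 d3 w3]] := exec_write_output sz i0 i1 i2 om rho B16 q_gt0 Bw inpB hB m2 b2.
have L_gt0 : 0 < L by move: L_ge nN; case: L {L_min m2 b2 m3 d2} => //=; lia.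
exists s3; split.
- by apply: exec_seq x1 _; apply: exec_seq x2 x3.
- apply/setP => x; rewrite inE -/m m3 // (chosen_flagE esE).
  by case: (x \in _).
(* Of the 202, [main] takes 200 and the two outer instructions take the rest. *)
- have h1 : step_cost * nT.+1 + step_cost * nS.+1 <= 2 * step_cost * (N + m + 1).
    rewrite -mulnDr [2 * _]mulnC -mulnA leq_mul2l; apply/orP; right; move: nN; clear; lia.
  move: w1 w2 w3 h1; rewrite -/N -/m; move: (step_cost) => k; rewrite !mulnDr; clear; lia.
- have h1 : step_cost * 1 <= step_cost * L by rewrite leq_mul2l L_gt0 orbT.
  move: d1 d2 d3 h1; move: (step_cost) => k; clear; lia.
Qed.

(** The 5 is 3 + 2: [A = ((q + 1) / q) ^ 2] is at most [1 + 3 / q], and the first bucket contributes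
    at most [2 / q] by [weight0_bound]. *)
Lemma expectation_chosen (R : realFieldType) nS nT (E : {set 'I_nS * 'I_nT}) C f q L
    w D K (pos : 'I_nT -> 'I_D * 'I_K) :
  let N := q * q * (nS + nT + 1) in
  0 < q -> q * N <= 2 ^ w -> injective pos -> is_cover E C ->
  (forall t : 'I_nT, #|sets_containing E t| <= f) ->
  (expectation (fun om : tape w D K =>
     (#|chosen E (fun t => bucket_of q (om (pos t) %% N)) L|%:R)%R)
   <= (1 + 5 / q%:R) * f%:R * #|C|%:R :> R)%R.
Proof.
move=> N q_gt0 qN pos_inj cov hf; rewrite /expectation.
have N_gt0 : 0 < N by rewrite /N; nia.
have qa : q <= 2 ^ w %/ N by rewrite leq_divRL.
have M_gt0 : 0 < 2 ^ w by rewrite expn_gt0.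
pose beta (x : 'I_(2 ^ w)) := bucket_of q (x %% N).
pose A : R := ((q.+1 ^ 2)%:R / (q ^ 2)%:R)%R.
have q2 : (0 < (q ^ 2)%:R :> R)%R by rewrite ltr0n expn_gt0 q_gt0.
have q1 : (0 < q%:R :> R)%R by rewrite ltr0n.
rewrite ler_pdivrMr; last by rewrite ltr0n; apply/card_gt0P; exists [ffun=> Ordinal M_gt0].
apply: (@sum_card_chosen _ _ E R _ _ beta pos A _ pos_inj) => //.
- by rewrite divr_ge0 ?ler0n.
- move=> j; rewrite /A mulrAC ler_pdivlMr // -!natrM ler_nat mulnC; exact: weight_growth.
have h : nT * #|[set x | beta x == 0]| * q <= 2 * 2 ^ w.
  apply: (@weight0_bound q q_gt0 (2 ^ w) N N_gt0 nT); first exact: leq_trans qa.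
  by rewrite /N -mulnn leq_mul2l; apply/orP; right; lia.
rewrite card_ord.
have h1 : (nT%:R * (#|[set x | beta x == 0]|%:R / (2 ^ w)%:R) <= 2 / q%:R :> R)%R.
  rewrite mulrA ler_pdivrMr ?ltr0n // mulrAC ler_pdivlMr // -!natrM.
  by rewrite ler_nat.
have h2 : (A <= 1 + 3 / q%:R)%R.
  rewrite /A ler_pdivrMr // !natrX -[(q.+1%:R)%R]natr1; set x := (q%:R)%R.
  have x1 : (1 <= x)%R by rewrite ler1n.
  rewrite (_ : (1 + 3 / x) * x ^+ 2 = x ^+ 2 + 3 * x)%R; last by field; rewrite gt_eqF // (lt_le_trans ltr01).
  nra.
apply: le_trans (lerD h2 h1) _; lra.
Qed.

Lemma resource_bounds q nS nT m L :
  let n := nS + nT in let lg := (trunc_log 2 n).+1 in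
  let N := q * q * (nS + nT + 1) in
  L <= (2 * q * (2 * q + 1) + 1) * lg ->
  202 * step_cost * L <= time_factor q * lg /\
  202 * step_cost * (N + m + 1) <= time_factor q * (n + m).+1.
Proof.
move=> n lg N Lb; rewrite /time_factor; move: (202 * step_cost) => k; rewrite -!(mulnA k); split.
  rewrite leq_mul2l; apply/orP; right; apply: leq_trans Lb _.
  by rewrite leq_mul2r -addnA leq_addl orbT.
rewrite leq_mul2l; apply/orP; right.
have : q * q * (n + 1) <= q * q * (n + m).+1 by rewrite leq_mul2l; apply/orP; right; lia.
rewrite /N -/n !mulnDl; lia.
Qed.

Lemma time_factor_ge q : 202 <= time_factor q.
Proof.
have h : 1 <= step_cost by [].
rewrite /time_factor; apply: leq_trans (_ : 202 * step_cost * 1 <= _).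
  by rewrite muln1 leq_pmulr.
by rewrite leq_mul2l; apply/orP; right; rewrite leq_addl.
Qed.

Local Open Scope ring_scope.

Theorem theorem7p1 (R : realType) (eps : R) (eps_gt0 : 0 < eps) (eps_lt : eps < 1 / 2) :
  exists (P : cmd) (c C : nat),
  forall (nS nT : nat) (E : {set 'I_nS * 'I_nT}) (es : seq ('I_nS * 'I_nT)) (f : nat),
  is_cover E [set: 'I_nS] ->
  (forall t : 'I_nT, (#|sets_containing E t| <= f)%N) ->
  uniq es -> es =i E ->
  let n := (nS + nT)%N in
  let m := #|E| in
  let w := (c * (trunc_log 2 n).+1)%N in
  let D := (C * (trunc_log 2 n).+1)%N in
  let K := (C * (n + m).+1)%N in
  forall rho : tape w D K -> nat -> nat -> nat,
  exists final : tape w D K -> state,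
    (forall om : tape w D K,
      [/\ exec om (rho om) P (init_state es) (final om),
          is_cover E (output es (final om)),
          (work (final om) <= K)%N
        & (depth (final om) <= D)%N])
    /\ expectation (fun om : tape w D K => #|output es (final om)|%:R)
         <= (1 + eps) * f%:R * (min_cover_size E)%:R.
Proof.
(* [q] exceeds [5 / eps], which turns [1 + 5 / q] into at most [1 + eps]. *)
have q_eps := archi_boundP (divr_ge0 (ler0n R 5) (ltW eps_gt0)).
set q := Num.bound _ in q_eps.
have q_gt0 : (0 < q)%N.
  by rewrite -(ltr0n R); apply: le_lt_trans q_eps; rewrite divr_ge0 ?ler0n // ltW.
exists (program q), (word_factor q), (time_factor q) => nS nT E es f cov hf es_uniq esE n m w D K rho.
have m_es : size es = m by rewrite -(card_uniqP es_uniq); apply: eq_card.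
have m_ub : (m <= nS * nT)%N.
  by apply: leq_trans (max_card _) _; rewrite card_prod !card_ord.
set N := (q * q * (nS + nT + 1))%N.
have Bw : ((10 * (N + m + 1) + 16) ^ max_cost < 2 ^ w)%N := memory_bound q_gt0 m_ub.
have [L [L_ge L_min L_ub]] := rounds_exist q_gt0 N.
have [hD hK] := @resource_bounds q nS nT m L (rounds_bound q_gt0 m_ub L_ub).
have C_ge := time_factor_ge q.
have D_gt : (2 < D)%N by rewrite /D; move: C_ge; nia.
have K_ge : (nT <= K)%N by rewrite /K; move: C_ge; rewrite /n; nia.
(* Element [t] takes its time from the word read at time 2 by processor [t]. *)
pose pos (t : 'I_nT) : 'I_D * 'I_K := (Ordinal D_gt, widen_ord K_ge t).
have pos_inj : injective pos by move=> t t' [] tt'; apply: val_inj.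
have drawnE (om : tape w D K) (t : 'I_nT) : drawn nS nT q om t = (om (pos t) %% N)%N.
  rewrite /drawn ltn_ord /draw !insubT; first exact: leq_trans (ltn_ord t) K_ge.
  by move=> lt; congr (val (om (_, _)) %% _)%N; apply: val_inj.
have run om : exists s, [/\ exec om (rho om) (program q) (init_state es) s,
    output es s = chosen E (fun t => bucket_of q (om (pos t) %% N)) L,
    (work s <= K)%N & (depth s <= D)%N].
  have [||||s [x o ws ds]] := @exec_program nS nT E es q L w D K om (rho om) q_gt0 esE; rewrite ?m_es //.
  rewrite m_es in ws; exists s; split => //; [|exact: leq_trans hK|exact: leq_trans hD].
  by rewrite o; apply: chosen_adapted => t _; rewrite drawnE.
have {run} [final run] := fin_all_exists run.
exists final; split.
  move=> om; have [x -> ws ds] := run om; split => //.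
  apply: chosen_is_cover => // t; rewrite bucket_of_lt //; apply: leq_trans L_ge.
  by rewrite ltn_pmod // /N !muln_gt0 q_gt0 addn1.
rewrite /min_cover_size; case: arg_minnP => // C covC _.
have -> : expectation (fun om : tape w D K => #|output es (final om)|%:R) =
    expectation (fun om : tape w D K =>
      #|chosen E (fun t => bucket_of q (om (pos t) %% N)) L|%:R) :> R.
  by congr (_ / _); apply: eq_bigr => om _; have [_ -> _ _] := run om.
(* A word must span at least [q] periods of length [N] for the remainders to be nearly uniform;
   [B ^ 2 <= B ^ max_cost] suffices. *)
have qN : (q * N <= 2 ^ w)%N.
  apply: ltnW; apply: leq_ltn_trans Bw; set B := (_ + 16)%N.
  have qN : (q <= N)%N by rewrite /N -mulnA leq_pmulr // muln_gt0 q_gt0 addn1.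
  have NB : (N <= B)%N by rewrite /B; lia.
  apply: leq_trans (_ : B ^ 2 <= _)%N; first by rewrite -mulnn leq_mul // (leq_trans qN).
  by rewrite leq_pexp2l // /B addn_gt0 orbT.
have H := @expectation_chosen R _ _ E C f q L w D K pos q_gt0 qN pos_inj covC hf.
apply: le_trans H _.
rewrite ler_wpM2r ?ler0n // ler_wpM2r ?ler0n // lerD2l.
have q1 : 0 < q%:R :> R by rewrite ltr0n.
by rewrite ler_pdivrMr // mulrC -ler_pdivrMr // ltW.
Qed.
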